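(* Let $w\in S_n$. The set $\mathsf{Pipes}(w)$ is closed under applying droops and K-theoretic droops. Furthermore, any $\mathcal P\in\mathsf{Pipes}(w)$ can be reached from $\Phi(w)$ by applying a sequence of droops and K-theoretic droops.
   Context: Bumpless pipe dreams. Cells $(i,j)$ of the $n\times n$ grid: row $i$ from the top, column $j$ from the left. There are six tiles: downward elbow (a pipe joining the bottom and right edges), upward elbow (a pipe joining the left and top edges), crossing (one pipe joining left and right edges and one joining bottom and top edges), blank (no pipe), horizontal (left to right), vertical (bottom to top). A bumpless pipe dream (BPD) of size $n$ is a tiling of the grid by these tiles such that an edge shared by two cells is met by a pipe from both sides or from neither, every bottom and right boundary edge is met by a pipe, and no left or top boundary edge is met by a pipe. A BPD is determined by the positions of its downward elbows and of its upward elbows. $\Phi(w)$ is the Rothe BPD of $w$: the unique BPD with downward elbows exactly at the positions $(i,w(i))$, $i=1,\dots,n$, and no upward elbows. Demazure product $\partial(\mathcal P)\in S_n$: label the bottom boundary edges $1,\dots,n$ from left to right and propagate labels along pipes north and east; at a crossing tile, of the two labels entering from the left and from below, the smaller leaves through the right edge and the larger through the top edge. $\partial(\mathcal P)(i)$ is the label arriving at the right boundary edge of row $i$. $\mathsf{Pipes}(w)$ is the set of BPDs $\mathcal P$ of size $n$ with $\partial(\mathcal P)=w$. In each of the following moves, $R=[i,a]\times[j,b]$ is a rectangle of cells with $i<a$, $j<b$; the elbow tiles outside $R$ are unchanged, and the new BPD is the one determined by the new set of elbow tiles. Droop: allowed when $(i,j)$ is a downward elbow, $(a,b)$ is blank,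 and $R$ contains no other elbow tiles. In the new BPD the elbow tiles in $R$ are exactly: downward elbows at $(a,j)$ and $(i,b)$ and an upward elbow at $(a,b)$. K-theoretic droop, first type: for some $j<j'<b$, allowed when the elbow tiles in $R$ are exactly downward elbows at $(i,j)$ and $(a,j')$ and an upward elbow at $(a,b)$. In the new BPD the elbow tiles in $R$ are exactly downward elbows at $(a,j)$ and $(i,j')$ and an upward elbow at $(a,b)$. K-theoretic droop, second type: for some $i<i'<a$, allowed when the elbow tiles in $R$ are exactly downward elbows at $(i,j)$ and $(i',b)$ and an upward elbow at $(a,b)$. In the new BPD the elbow tiles in $R$ are exactly downward elbows at $(i',j)$ and $(i,b)$ and an upward elbow at $(a,b)$. *)

(* Defs.v *)
From HB Require Import structures.
From mathcomp Require Import all_boot all_order all_fingroup all_algebra.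
From Stdlib Require Export Relations.Relation_Operators.

Set Implicit Arguments.
Unset Strict Implicit.
Unset Printing Implicit Defensive.

Variant tile : predArgType :=
  DownElbow | UpElbow | Crossing | Blank | Horizontal | Vertical.

Definition meets_left (t : tile) : bool :=
  match t with UpElbow | Crossing | Horizontal => true | _ => false end.
Definition meets_right (t : tile) : bool :=
  match t with DownElbow | Crossing | Horizontal => true | _ => false end.
Definition meets_top (t : tile) : bool :=
  match t with UpElbow | Crossing | Vertical => true | _ => false end.
Definition meets_bottom (t : tile) : bool :=
  match t with DownElbow | Crossing | Vertical => true | _ => false end.

Definition tile_code (t : tile) : bool * bool * (bool * bool) :=
  (meets_left t, meets_right t, (meets_top t, meets_bottom t)).
Definition tile_decode (c : bool * bool * (bool * bool)) : option tile :=
  match c with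
  | (false, true, (false, true)) => Some DownElbow
  | (true, false, (true, false)) => Some UpElbow
  | (true, true, (true, true)) => Some Crossing
  | (false, false, (false, false)) => Some Blank
  | (true, true, (false, false)) => Some Horizontal
  | (false, false, (true, true)) => Some Vertical
  | _ => None
  end.
Lemma tile_codeK : pcancel tile_code tile_decode.
Proof. by case. Qed.
HB.instance Definition _ := Equality.copy tile (pcan_type tile_codeK).
HB.instance Definition _ := Choice.copy tile (pcan_type tile_codeK).
HB.instance Definition _ := Countable.copy tile (pcan_type tile_codeK).
HB.instance Definition _ := Finite.copy tile (pcan_type tile_codeK).

(* Rows and columns are numbered from 0; row 0 is the top row. *)
Definition is_bpd (n : nat) (P : 'M[tile]_n) : bool :=
  [&& [forall i : 'I_n, forall j : 'I_n, forall j' : 'I_n,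
         (j' == j.+1 :> nat) ==> (meets_right (P i j) == meets_left (P i j'))],
      [forall i : 'I_n, forall i' : 'I_n, forall j : 'I_n,
         (i' == i.+1 :> nat) ==> (meets_bottom (P i j) == meets_top (P i' j))]
    & [forall i : 'I_n, forall j : 'I_n,
         [&& (j.+1 == n) ==> meets_right (P i j),
             (i.+1 == n) ==> meets_bottom (P i j),
             (j == 0 :> nat) ==> ~~ meets_left (P i j)
           & (i == 0 :> nat) ==> ~~ meets_top (P i j)]]].

Record bpd (n : nat) : predArgType :=
  Bpd { tiling :> 'M[tile]_n; _ : is_bpd tiling }.
HB.instance Definition _ (n : nat) := [isSub for @tiling n].
HB.instance Definition _ (n : nat) := [Finite of bpd n by <:].

Notation cell n := ('I_n * 'I_n)%type.

Definition downs (n : nat) (P : 'M[tile]_n) : {set cell n} :=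
  [set c | P c.1 c.2 == DownElbow].
Definition ups (n : nat) (P : 'M[tile]_n) : {set cell n} :=
  [set c | P c.1 c.2 == UpElbow].

Lemma bpd_elbows_inj (n : nat) (P Q : bpd n) :
  downs P = downs Q -> ups P = ups Q -> P = Q.
Proof.
move=> eqD eqU; apply: val_inj; apply/matrixP => i j /=.
have [m] := ubnP (i + j); elim: m i j => // m IHm i j le_ij_m.
have eD : (P i j == DownElbow) = (Q i j == DownElbow).
  by move/setP/(_ (i, j)): eqD; rewrite !inE.
have eU : (P i j == UpElbow) = (Q i j == UpElbow).
  by move/setP/(_ (i, j)): eqU; rewrite !inE.
have eL : meets_left (P i j) = meets_left (Q i j).
  have /and3P[/forallP/(_ i) HP _ /forallP/(_ i)/forallP/(_ j)/and4P[_ _ P0 _]] := valP P.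
  have /and3P[/forallP/(_ i) HQ _ /forallP/(_ i)/forallP/(_ j)/and4P[_ _ Q0 _]] := valP Q.
  have [j0|j_gt0] := posnP j.
    by move: P0 Q0; rewrite j0 eqxx /= => /negbTE -> /negbTE ->.
  have lt_j'n : j.-1 < n by rewrite (leq_ltn_trans (leq_pred j)).
  pose j' := Ordinal lt_j'n.
  have Ej : (j == j'.+1 :> nat) by rewrite /= prednK.
  move/forallP/(_ j')/forallP/(_ j): HP; move/forallP/(_ j')/forallP/(_ j): HQ.
  rewrite Ej /= => /eqP <- /eqP <-; rewrite (IHm i j') //.
  by rewrite -ltnS (leq_trans _ le_ij_m) // ltnS /= -addnS prednK.
have eT : meets_top (P i j) = meets_top (Q i j).
  have /and3P[_ HP /forallP/(_ i)/forallP/(_ j)/and4P[_ _ _ P0]] := valP P.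
  have /and3P[_ HQ /forallP/(_ i)/forallP/(_ j)/and4P[_ _ _ Q0]] := valP Q.
  have [i0|i_gt0] := posnP i.
    by move: P0 Q0; rewrite i0 eqxx /= => /negbTE -> /negbTE ->.
  have lt_i'n : i.-1 < n by rewrite (leq_ltn_trans (leq_pred i)).
  pose i' := Ordinal lt_i'n.
  have Ei : (i == i'.+1 :> nat) by rewrite /= prednK.
  move/forallP/(_ i')/forallP/(_ i)/forallP/(_ j): HP.
  move/forallP/(_ i')/forallP/(_ i)/forallP/(_ j): HQ.
  rewrite Ei /= => /eqP <- /eqP <-; rewrite (IHm i' j) //.
  by rewrite -ltnS (leq_trans _ le_ij_m) // ltnS /= -addSn prednK.
by move: eD eU eL eT; case: (P i j); case: (Q i j).
Qed.

Definition bpd_of_elbows (n : nat) (D U : {set cell n}) : option (bpd n) :=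
  [pick P : bpd n | (downs P == D) && (ups P == U)].

Lemma bpd_of_elbowsP (n : nat) (D U : {set cell n}) (P : bpd n) :
  bpd_of_elbows D U = Some P <-> downs P = D /\ ups P = U.
Proof.
rewrite /bpd_of_elbows; case: pickP => [Q /andP[/eqP dQ /eqP uQ] | noP].
  split=> [[<-] // | [dP uP]].
  by congr Some; apply: bpd_elbows_inj; rewrite ?dQ ?uQ.
by split=> // -[dP uP]; have := noP P; rewrite dP uP !eqxx.
Qed.

Definition rothe_tiling (n : nat) (w : 'S_n) : 'M[tile]_n :=
  \matrix_(i < n, j < n)
    if w i == j then DownElbow
    else match w i < j, (w^-1)%g j < i with
         | true, true => Crossing
         | true, false => Horizontal
         | false, true => Vertical
         | false, false => Blank
         end.

Lemma rotheP (n : nat) (w : 'S_n) : is_bpd (rothe_tiling w).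
Proof.
have E (i j : 'I_n) : (w i == j) = ((w^-1)%g j == i).
  by rewrite -(inj_eq (@perm_inj _ w) ((w^-1)%g j)) permKV eq_sym.
have L (i j : 'I_n) : meets_left (rothe_tiling w i j) = (w i < j).
  rewrite mxE; case: eqP => [->|_]; first by rewrite ltnn.
  by case: (w i < j); case: (_ < i).
have T (i j : 'I_n) : meets_top (rothe_tiling w i j) = ((w^-1)%g j < i).
  rewrite mxE E; case: eqP => [->|_]; first by rewrite ltnn.
  by case: (w i < j); case: (_ < i).
have R (i j : 'I_n) : meets_right (rothe_tiling w i j) = (w i < j.+1).
  rewrite mxE ltnS [in RHS]leq_eqVlt -[(w i == j :> nat)]/(w i == j).
  by case: (w i == j); case: (w i < j); case: (_ < i).
have B (i j : 'I_n) : meets_bottom (rothe_tiling w i j) = ((w^-1)%g j < i.+1).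
  rewrite mxE E ltnS [in RHS]leq_eqVlt -[((w^-1)%g j == i :> nat)]/((w^-1)%g j == i).
  by case: ((w^-1)%g j == i); case: (w i < j); case: (_ < i).
apply/and3P; split; apply/forallP => i; apply/forallP => j.
- by apply/forallP => j'; rewrite R L; apply/implyP => /eqP ->.
- by apply/forallP => k; rewrite B T; apply/implyP => /eqP ->.
by rewrite L T R B; apply/and4P; split; apply/implyP => /eqP ->.
Qed.

Definition rothe (n : nat) (w : 'S_n) : bpd n := Bpd (rotheP w).

Lemma rothe_elbows (n : nat) (w : 'S_n) :
  downs (rothe w) = [set (i, w i) | i : 'I_n] /\ ups (rothe w) = set0.
Proof.
split; apply/setP => -[i j]; rewrite !inE mxE /=.
  apply/idP/imsetP => [|[k _ [-> ->]]]; last by rewrite eqxx.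
  case: (w i =P j) => [<- _|_]; [by exists i | by case: (w i < j); case: (_ < i)].
by case: (w i =P j) => // _; case: (w i < j); case: (_ < i).
Qed.

(* [propagate t l b] is the pair of the labels on the right and top edges of a
   cell with tile [t], given the labels [l] and [b] on its left and bottom
   edges; an edge not met by a pipe has label [None]. *)
Definition propagate (n : nat) (t : tile) (l b : option 'I_n) :
    option 'I_n * option 'I_n :=
  match t with
  | DownElbow => (b, None)
  | UpElbow => (None, l)
  | Crossing =>
      if (l, b) is (Some x, Some y) then (Some (Order.min x y), Some (Order.max x y))
      else (None, None)
  | Blank => (None, None)
  | Horizontal => (l, None)
  | Vertical => (None, b)
  end.

(* [v j] is the label on the bottom edge of cell (i, j). *)
Definition label_after (n : nat) (P : 'M[tile]_n) (i : 'I_n)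
    (v : 'I_n -> option 'I_n) (js : seq 'I_n) : option 'I_n :=
  foldl (fun l j => (propagate (P i j) l (v j)).1) None js.

Definition labels_above (n : nat) (P : 'M[tile]_n) (i : 'I_n)
    (v : 'I_n -> option 'I_n) (j : 'I_n) : option 'I_n :=
  (propagate (P i j) (label_after P i v (take j (enum 'I_n))) (v j)).2.

(* Rows are traversed from the bottom one up to row i.+1; the bottom boundary
   edge of column j has label j. *)
Definition labels_below (n : nat) (P : 'M[tile]_n) (i : 'I_n) :
    'I_n -> option 'I_n :=
  foldr (labels_above P) Some (drop i.+1 (enum 'I_n)).

Definition demazure (n : nat) (P : 'M[tile]_n) (i : 'I_n) : option 'I_n :=
  label_after P i (labels_below P i) (enum 'I_n).

Definition Pipes (n : nat) (w : 'S_n) : {set bpd n} :=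
  [set P : bpd n | [forall i, demazure P i == Some (w i)]].

Lemma rothe_Pipes (n : nat) (w : 'S_n) : rothe w \in Pipes w.
Proof.
have minE (x y : 'I_n) : x < y -> Order.min x y = x /\ Order.max x y = y.
  by move=> lxy; rewrite /Order.min /Order.max; have -> : (x < y)%O by [].
have E (i j : 'I_n) : (w i == j) = ((w^-1)%g j == i).
  by rewrite -(inj_eq (@perm_inj _ w) ((w^-1)%g j)) permKV eq_sym.
pose act (i : nat) (j : 'I_n) := if (w^-1)%g j < i then Some j else None.
have szE : size (enum 'I_n) = n by rewrite size_enum_ord.
have row (i : 'I_n) (v : 'I_n -> option 'I_n) (k : nat) : v =1 act i.+1 -> k <= n ->
    label_after (rothe w) i v (take k (enum 'I_n)) = if w i < k then Some (w i) else None.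
  move=> Ev; elim: k => [|k IHk] lekn; first by rewrite take0.
  rewrite (take_nth (w i)) ?szE // /label_after foldl_rcons -/(label_after _ _ _ _).
  rewrite IHk ?(ltnW lekn) //; set j := nth _ _ _.
  have jk : j = k :> nat by rewrite /j nth_enum_ord.
  rewrite Ev /act mxE E -jk (ltnS (w i)) (leq_eqVlt (w i) j) -[(w i == j :> nat)]/(w i == j) E.
  case: eqP => [e|ne] /=; first by rewrite -e leqnn permKV.
  have nei : ((w^-1)%g j < i.+1) = ((w^-1)%g j < i).
    by rewrite ltnS leq_eqVlt; case: eqP => // /val_inj.
  rewrite nei; case: ltnP => // lt; case: ltnP => // _ /=.
  by rewrite (minE _ _ lt).1.
have below k : k <= n -> foldr (labels_above (rothe w)) Some (drop k (enum 'I_n)) =1 act k.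
  move=> lekn; rewrite -(subKn lekn); elim: (n - k) (leq_subr k n) => [|m IHm] lemn j.
    by rewrite subn0 drop_oversize ?szE //= /act ltn_ord.
  have lt : n - m.+1 < n by rewrite ltn_subrL (leq_trans _ lemn).
  rewrite (drop_nth j) ?szE //=; set i := nth _ _ _.
  have ik : i = n - m.+1 :> nat by rewrite /i nth_enum_ord.
  have Hv := IHm (ltnW lemn); rewrite (_ : n - m = i.+1) in Hv; last by rewrite ik -subSn.
  rewrite (_ : (n - m.+1).+1 = n - m); last by rewrite -subSn.
  rewrite -ik (_ : n - m = i.+1); last by rewrite ik -subSn.
  rewrite /labels_above row //; last exact: ltnW.
  rewrite Hv /act mxE E.
  case: eqP => [->|ne] /=; first by rewrite ltnn.
  have nei : ((w^-1)%g j < i.+1) = ((w^-1)%g j < i).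
    by rewrite ltnS leq_eqVlt; case: eqP => // /val_inj.
  rewrite nei; case: ltnP => lt' //=; case: ltnP => //= _.
  by rewrite (minE _ _ lt').2.
rewrite inE; apply/forallP => i; apply/eqP.
rewrite /demazure -{1}(take_size (enum 'I_n)) szE row ?ltn_ord //.
exact: below.
Qed.

(* [Droop i a j b], [KDroop1 i a j j' b] and [KDroop2 i i' a j b] are moves in
   the rectangle [i, a] x [j, b]. *)
Variant move (n : nat) : Type :=
  | Droop (i a j b : 'I_n)
  | KDroop1 (i a j j' b : 'I_n)
  | KDroop2 (i i' a j b : 'I_n).

Definition rect (n : nat) (i a j b : 'I_n) : {set cell n} :=
  [set c : cell n | (i <= c.1 <= a) && (j <= c.2 <= b)].

Definition region (n : nat) (m : move n) : {set cell n} :=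
  match m with
  | Droop i a j b => rect i a j b
  | KDroop1 i a j j' b => rect i a j b
  | KDroop2 i i' a j b => rect i a j b
  end.

Definition elbows_in (n : nat) (P : 'M[tile]_n) (R D U : {set cell n}) : bool :=
  (downs P :&: R == D) && (ups P :&: R == U).

Definition allowed (n : nat) (P : 'M[tile]_n) (m : move n) : bool :=
  match m with
  | Droop i a j b =>
      [&& i < a, j < b, P a b == Blank
        & elbows_in P (region m) [set (i, j)] set0]
  | KDroop1 i a j j' b =>
      [&& i < a, j < j' < b
        & elbows_in P (region m) [set (i, j); (a, j')] [set (a, b)]]
  | KDroop2 i i' a j b =>
      [&& i < i' < a, j < b
        & elbows_in P (region m) [set (i, j); (i', b)] [set (a, b)]]
  end.

Definition new_downs (n : nat) (m : move n) : {set cell n} :=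
  match m with
  | Droop i a j b => [set (a, j); (i, b)]
  | KDroop1 i a j j' b => [set (a, j); (i, j')]
  | KDroop2 i i' a j b => [set (i', j); (i, b)]
  end.

Definition new_ups (n : nat) (m : move n) : {set cell n} :=
  match m with
  | Droop i a j b => [set (a, b)]
  | KDroop1 i a j j' b => [set (a, b)]
  | KDroop2 i i' a j b => [set (a, b)]
  end.

Definition apply_move (n : nat) (P : 'M[tile]_n) (m : move n) : option (bpd n) :=
  bpd_of_elbows ((downs P :\: region m) :|: new_downs m)
                ((ups P :\: region m) :|: new_ups m).

Definition move_step (n : nat) (P Q : bpd n) : Prop :=
  exists2 m : move n, allowed P m & apply_move P m = Some Q.

(* Main.v *)
(** For a threshold [k], let [H(x, y)] count the labels at least [k] on the line
    above row [x], in columns to the left of [y].  Whatever the tiles,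
    [H(x, y+1) = min (H(x, y) + v(x, y), H(x+1, y+1))], where [v(x, y)] tells
    whether a pipe crosses that line in column [y]; so [H] is a least cost over
    west-south lattice paths, and its values on the right boundary for all [k]
    determine the Demazure product.  Every droop or K-theoretic droop is a
    "slide": it toggles the edges along the border of a rectangle (the rectangle
    of a K-theoretic droop being cut at its middle elbow), and a path that gains
    or loses by the toggle can be rerouted around the rectangle of the move.
    Conversely, let [(a, b)] be a topmost upward elbow and [(a, j)] the downward
    elbow to its left; the lowest downward elbow above row [a] in the columns
    [j+1..b] is the corner of an inverse droop (in column [b]) or of an inverse
    K-theoretic droop of the first type.  Inverse slides shift vertical edges to
    the left, so they end at a BPD without upward elbows, a Rothe BPD. *)
Require Import Defs.
From mathcomp Require Import all_boot all_order all_fingroup matrix zify.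
Set Implicit Arguments.
Unset Strict Implicit.
Unset Printing Implicit Defensive.

(** * Rerouting lattice paths *)

Lemma leq_sum_nat (m n : nat) (F G : nat -> nat) :
    (forall t, m <= t < n -> F t <= G t) ->
  \sum_(m <= t < n) F t <= \sum_(m <= t < n) G t.
Proof. by move=> le_FG; rewrite !(big_nat _ _ m n); apply: leq_sum. Qed.

Lemma lattice_sum_bound (n : nat) (v H : nat -> nat -> nat) (x y z : nat) :
    (forall t, t < n -> H x t.+1 <= H x t + v x t) ->
  y <= z -> z <= n -> H x z <= H x y + \sum_(y <= t < z) v x t.
Proof.
move=> hH; elim: z => [|z IHz] le_yz le_zn.
  by move: le_yz; rewrite leqn0 => /eqP->; rewrite big_geq ?addn0.
have [->|ne] := eqVneq y z.+1; first by rewrite big_geq ?addn0.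
rewrite big_nat_recr /=; last by lia.
by have := hH z le_zn; have := IHz; lia.
Qed.

(** A least-cost west-south path for [H2] is followed and replaced by a path for [H1] that costs no
    more; so [H2] must attain its minimum, while for [H1] one inequality per kind of step suffices.
    By [v_row] crossing a whole line of the rectangle gets no dearer, by [v_col] a staircase can be
    pushed up to the line where it starts, and by [v_corner] a path that leaves southwards can
    instead descend east of the rectangle and run west below it. *)
Lemma path_min_le (n i a j b : nat) (v1 v2 H1 H2 : nat -> nat -> nat) :
    i < a -> a < n -> j < b -> b < n ->
    (forall x y, ~~ ((i < x <= a) && (j <= y <= b)) -> v1 x y = v2 x y) ->
    (forall x, i < x <= a ->
       \sum_(j <= t < b.+1) v1 x t <= \sum_(j <= t < b.+1) v2 x t) ->
    (forall x t, i <= x < a -> j <= t < b -> v2 x t <= v2 x.+1 t) ->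
    (forall x y, i < x <= a -> j < y <= b ->
       \sum_(y <= t < b.+1) v2 a.+1 t <= \sum_(y <= t < b.+1) v2 x t) ->
    (forall x, H1 x 0 = 0) -> (forall y, y <= n -> H1 n y = H2 n y) ->
    (forall x y, x <= n -> y < n -> H1 x y.+1 <= H1 x y + v1 x y) ->
    (forall x y, x < n -> y < n -> H1 x y.+1 <= H1 x.+1 y.+1) ->
    (forall x y, x < n -> y < n ->
       H2 x y.+1 = minn (H2 x y + v2 x y) (H2 x.+1 y.+1)) ->
  forall x, x <= n -> H1 x n <= H2 x n.
Proof.
move=> lt_ia lt_an lt_jb lt_bn v_out v_row v_col v_corner H10 H1n H1W H1S H2min.
have v1i t : v1 i t = v2 i t by apply: v_out; lia.
have v1a t : v1 a.+1 t = v2 a.+1 t by apply: v_out; lia.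
have H1sum x y z : x <= n -> y <= z -> z <= n ->
    H1 x z <= H1 x y + \sum_(y <= t < z) v1 x t.
  by move=> ltxn; apply: lattice_sum_bound => t; apply: H1W.
have H1mono x x' y : x <= x' -> x' < n -> y <= n -> H1 x y <= H1 x' y.
  move=> le_xx' ltx'n; case: y => [|y] ltyn; first by rewrite !H10.
  elim: x' le_xx' ltx'n => [|x' IHx'] le_xx' ltx'n; first by have -> : x = 0 by lia.
  have [->//|ne] := eqVneq x x'.+1.
  by have := H1S x' y; have := IHx'; lia.
have H1mono1 x y : x < n -> y <= n -> H1 x y <= H1 x.+1 y.
  by case: y => [|y] ltxn ltyn; [rewrite !H10 | apply: H1S].
have below y : y <= n -> H1 a y <= H1 a.+1 y by move=> ?; apply: H1mono1.
(* Inside the rectangle a path is only known by its exit: west through column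
   [j] on its own line, or south from line [a] in some column [z]. *)
pose claim x y :=
  if (i < x <= a) && (j < y <= b) then
    H1 x j + \sum_(j <= t < y) v2 x t <= H2 x y
    \/ (exists2 z, j < z <= y & H1 a.+1 z + \sum_(z <= t < y) v2 x t <= H2 x y)
  else H1 x y <= H2 x y.
(* The induction climbs from line [n], where [H1] and [H2] agree; [d] is the distance to that
   line. *)
suff H d : d <= n -> forall y, y <= n -> claim (n - d) y.
  move=> x le_xn; have := H _ (leq_subr x n) n (leqnn n); rewrite subKn // /claim.
  by case: ifP => //; lia.
elim: d => [_ y|d IHd lt_dn y] le_yn.
  rewrite subn0 /claim ifF; last by lia.
  by rewrite H1n.
have ltxn : n - d.+1 < n by lia.
have IHx z : z <= n -> claim (n - d.+1).+1 z.
  by move=> le_zn; have := IHd (ltnW lt_dn) z le_zn; have <- : n - d = (n - d.+1).+1 by lia.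
move: (n - d.+1) ltxn IHx => {IHd lt_dn} x ltxn IHx.
have le_xn := ltnW ltxn.
elim: y le_yn => [|y IHy] ltyn.
  by rewrite /claim ifF ?H10 //; lia.
have {IHy}HW := IHy (ltnW ltyn); have {IHx}HS := IHx _ ltyn.
(* The first step of a least-cost path from [(x, y.+1)] goes either west, at cost [v2 x y], or
   south, for free. *)
have [E|E] : H2 x y.+1 = H2 x y + v2 x y \/ H2 x y.+1 = H2 x.+1 y.+1.
  by rewrite H2min // /minn; case: ifP; [left | right].
- move: HW; rewrite /claim E; case: ifP => [in1|out1]; case: ifP => [in2|out2].
  + case=> [le1|[z le_z le1]]; [left|right; exists z].
    * by rewrite big_nat_recr /=; lia.
    * by lia.
    * by rewrite big_nat_recr /=; lia.
  (* The path enters through the east side. If it exits west, line [x] is crossed entirely and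
     [v_row] compares the costs; if it exits south, the replacement descends at once to line [a.+1],
     and [v_corner] compares. *)
  + have Ey : y = b by lia.
    have in1x : i < x <= a by lia.
    subst y; move=> -[le1|[z le_z le1]].
    * have := H1sum x j b.+1 le_xn; have := v_row x in1x.
      by rewrite [X in _ <= X](big_nat_recr b) /=; lia.
    * have := H1sum a.+1 z b.+1 lt_an; have := v_corner x z in1x le_z.
      rewrite (eq_bigr _ (fun t _ => v1a t)).
      rewrite [X in _ <= X](big_nat_recr b) /=; last by lia.
      have := H1mono x a b.+1; have := below b.+1; lia.
  + have -> : y = j by lia.
    by move=> le1; left; rewrite big_nat1; lia.
  + by move=> le1; have := H1W x y le_xn ltyn; rewrite v_out; lia.
- move: HS; rewrite /claim E; case: ifP => [in1|out1]; case: ifP => [in2|out2].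
  + have le_v z : j <= z ->
        \sum_(z <= t < y.+1) v2 x t <= \sum_(z <= t < y.+1) v2 x.+1 t.
      by move=> le_jz; apply: leq_sum_nat => t le_t; apply: v_col; lia.
    case=> [le1|[z le_z le1]]; [left|right; exists z => //].
    * by have := le_v j; have := H1mono1 x j; lia.
    * by have := le_v z; lia.
  (* The path enters from the north. The replacement stays on line [i], where both weights agree, as
     far as column [j] or column [z], and only then goes south. *)
  + have Ex : x = i by lia.
    subst x; have v_i z : j <= z ->
        \sum_(z <= t < y.+1) v1 i t <= \sum_(z <= t < y.+1) v2 i.+1 t.
      move=> le_jz; apply: leq_sum_nat => t le_t; rewrite v1i.
      by apply: v_col; lia.
    case=> [le1|[z le_z le1]].
    * have := v_i j; have := H1sum i j y.+1; have := H1mono1 i j; lia.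
    * have := v_i z; have := H1sum i z y.+1; have := H1mono i a z.
      have := below z; lia.
  + have <- : a = x by lia.
    move=> le1; right; exists y.+1; first by lia.
    by rewrite big_geq // addn0.
  + by move=> le1; have := H1S x y; lia.
Qed.

(** * Edges and labels of a BPD *)

(** Indexing by natural numbers leaves the arithmetic of positions to [lia]; the default [Blank]
    means that there is no elbow outside the grid. *)
Definition cell_at (n : nat) (P : 'M[tile]_n) (x y : nat) : tile :=
  if insub x is Some i then if insub y is Some j then P i j else Blank else Blank.

Lemma cell_atE (n : nat) (P : 'M[tile]_n) (i j : 'I_n) : cell_at P i j = P i j.
Proof. by rewrite /cell_at !valK. Qed.

(* [hedge P x y] is the edge between cells (x, y-1) and (x, y), and
   [vedge P x y] the edge between cells (x-1, y) and (x, y). *)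
Definition hedge (n : nat) (P : 'M[tile]_n) (x y : nat) : bool :=
  if y is y'.+1 then meets_right (cell_at P x y') else false.
Definition vedge (n : nat) (P : 'M[tile]_n) (x y : nat) : bool :=
  if x is x'.+1 then meets_bottom (cell_at P x' y) else false.

Definition label_geq (n k : nat) (o : option 'I_n) : bool :=
  if o is Some l then k <= l else false.

Lemma propagate_isSome (n : nat) (t : tile) (l b : option 'I_n) :
    isSome l = meets_left t -> isSome b = meets_bottom t ->
  isSome (propagate t l b).1 = meets_right t
  /\ isSome (propagate t l b).2 = meets_top t.
Proof. by case: t; case: l; case: b. Qed.

(** Call a label marked when it is at least [k]. At a crossing the maximum then becomes a
    disjunction and the minimum a conjunction: marks are conserved, and they go up whenever there is
    a top edge to carry them. *)
Lemma propagate_label_geq (n k : nat) (t : tile) (l b : option 'I_n) :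
    isSome l = meets_left t -> isSome b = meets_bottom t ->
  label_geq k (propagate t l b).2 + label_geq k (propagate t l b).1
    = label_geq k l + label_geq k b
  /\ (label_geq k (propagate t l b).2 : nat)
    = minn (meets_top t) (label_geq k l + label_geq k b).
Proof.
case: t; case: l => [l|//]; case: b => [b|//] //= _ _; rewrite ?minn0 ?min0n //.
all: try by (case: (k <= _)).
rewrite /Order.max /Order.min; have -> : (l < b)%O = (l < b) by [].
by case: ltnP => /= lt_lb; lia.
Qed.

Section Edges.
Variables (n : nat) (P : bpd n).

Lemma tile_code_cell_at (x y : nat) : x < n -> y < n ->
  tile_code (cell_at P x y) =
  (hedge P x y, hedge P x y.+1, (vedge P x y, vedge P x.+1 y)).
Proof.
move=> ltxn ltyn; have /and3P[/forallP hP /forallP vP /forallP bP] := valP P.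
rewrite /tile_code /=.
have -> : meets_left (cell_at P x y) = hedge P x y.
  have /forallP/(_ (Ordinal ltyn))/and4P[_ _ + _] := bP (Ordinal ltxn).
  rewrite -cell_atE /=; case: y ltyn => [|y] ltyn /=; first by move/negbTE.
  have /forallP/(_ (Ordinal (ltnW ltyn)))/forallP/(_ (Ordinal ltyn)) := hP (Ordinal ltxn).
  by rewrite -!cell_atE /= eqxx => /eqP.
congr (_, (_, _)).
have /forallP/(_ (Ordinal ltyn))/and4P[_ _ _] := bP (Ordinal ltxn).
rewrite -cell_atE /=; case: x ltxn => [|x] ltxn /=; first by move/negbTE.
have /forallP/(_ (Ordinal ltxn))/forallP/(_ (Ordinal ltyn)) := vP (Ordinal (ltnW ltxn)).
by rewrite -!cell_atE /= eqxx => /eqP.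
Qed.

Lemma hedge_last (x : nat) : x < n -> hedge P x n.
Proof.
move=> ltxn; have /and3P[_ _ /forallP bP] := valP P.
have En : n.-1.+1 = n by lia.
have ltn1 : n.-1 < n by lia.
have /forallP/(_ (Ordinal ltn1))/and4P[bPx _ _ _] := bP (Ordinal ltxn).
suff: hedge P x n.-1.+1 by rewrite En.
by move: bPx; rewrite -cell_atE /= En eqxx.
Qed.

Lemma vedge_last (y : nat) : y < n -> vedge P n y.
Proof.
move=> ltyn; have /and3P[_ _ /forallP bP] := valP P.
have En : n.-1.+1 = n by lia.
have ltn1 : n.-1 < n by lia.
have /forallP/(_ (Ordinal ltyn))/and4P[_ bPx _ _] := bP (Ordinal ltn1).
suff: vedge P n.-1.+1 y by rewrite En.
by move: bPx; rewrite -cell_atE /= En eqxx.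
Qed.

(** Truncating the folds behind [labels_below] and [demazure] names the label of every single edge,
    so that propagation becomes the local rule [propagate_labels]. *)
Definition col_label (x : nat) : 'I_n -> option 'I_n :=
  foldr (labels_above P) Some (drop x (enum 'I_n)).
Definition row_label (i : 'I_n) (y : nat) : option 'I_n :=
  label_after P i (labels_below P i) (take y (enum 'I_n)).

Lemma col_label_last (j : 'I_n) : col_label n j = Some j.
Proof. by rewrite /col_label drop_oversize ?size_enum_ord. Qed.

Lemma demazure_row_label (i : 'I_n) : demazure P i = row_label i n.
Proof. by rewrite /row_label take_oversize ?size_enum_ord. Qed.

Lemma propagate_labels (i j : 'I_n) :
  propagate (P i j) (row_label i j) (col_label i.+1 j)
  = (row_label i j.+1, col_label i j).
Proof.
rewrite [RHS]surjective_pairing [LHS]surjective_pairing /=; congr (_, _).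
  rewrite /row_label (take_nth j) ?size_enum_ord //.
  by rewrite nth_ord_enum /label_after foldl_rcons.
by rewrite [RHS]/col_label (drop_nth i) ?size_enum_ord // nth_ord_enum.
Qed.

Lemma row_label0 (i : 'I_n) : row_label i 0 = None.
Proof. by rewrite /row_label take0. Qed.

Lemma tile_edges (i j : 'I_n) :
  [/\ meets_left (P i j) = hedge P i j, meets_right (P i j) = hedge P i j.+1,
      meets_top (P i j) = vedge P i j & meets_bottom (P i j) = vedge P i.+1 j].
Proof.
by have := tile_code_cell_at (ltn_ord i) (ltn_ord j); rewrite cell_atE => -[-> -> -> ->].
Qed.

Lemma row_label_isSome (i : 'I_n) (y : nat) :
    (forall j : 'I_n, isSome (col_label i.+1 j) = vedge P i.+1 j) ->
  y <= n -> isSome (row_label i y) = hedge P i y.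
Proof.
move=> Hv; elim: y => [|y IHy] ltyn; first by rewrite row_label0.
pose j := Ordinal ltyn; have [El Er Et Eb] := tile_edges i j.
have := @propagate_isSome n (P i j) (row_label i j) (col_label i.+1 j).
by rewrite propagate_labels El Er Eb Hv IHy ?(ltnW ltyn) // => -[].
Qed.

Lemma col_label_isSome (x : nat) (j : 'I_n) : x <= n ->
  isSome (col_label x j) = vedge P x j.
Proof.
move=> le_xn; rewrite -(subKn le_xn); elim: (n - x) (leq_subr x n) j => [|d IHd] le_dn j.
  by rewrite subn0 col_label_last vedge_last.
have ltxn : n - d.+1 < n by lia.
have Ex : n - d = (n - d.+1).+1 by lia.
have := IHd (ltnW le_dn); rewrite Ex; move: (n - d.+1) ltxn => {le_xn le_dn Ex IHd x} x ltxn IHd.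
pose i := Ordinal ltxn; have [El Er Et Eb] := tile_edges i j.
have := @propagate_isSome n (P i j) (row_label i j) (col_label i.+1 j).
rewrite propagate_labels El Et Eb IHd row_label_isSome ?(ltnW (ltn_ord j)) //.
by case.
Qed.

(** This is the function H of the introduction. *)
Definition label_count (k x y : nat) : nat :=
  \sum_(j < n | j < y) label_geq k (col_label x j).

Lemma label_count0 (k x : nat) : label_count k x 0 = 0.
Proof. exact: big_pred0. Qed.

Lemma label_count_col (k x : nat) (j : 'I_n) :
  label_count k x j.+1 = label_count k x j + label_geq k (col_label x j).
Proof.
rewrite /label_count (bigD1 j) //= addnC; congr (_ + _); apply: eq_bigl => t.
by rewrite -(inj_eq val_inj) /=; lia.
Qed.

Lemma label_geq_propagate (k : nat) (i j : 'I_n) :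
  label_geq k (col_label i j) + label_geq k (row_label i j.+1)
    = label_geq k (row_label i j) + label_geq k (col_label i.+1 j)
  /\ (label_geq k (col_label i j) : nat)
    = minn (vedge P i j) (label_geq k (row_label i j) + label_geq k (col_label i.+1 j)).
Proof.
have [El Er Et Eb] := tile_edges i j.
have := @propagate_label_geq n k (P i j) (row_label i j) (col_label i.+1 j).
rewrite propagate_labels El Et Eb col_label_isSome //.
rewrite row_label_isSome ?(ltnW (ltn_ord j)) //; first by case.
by move=> t; apply: col_label_isSome.
Qed.

(** Marked labels are conserved in the first [y] cells of row [i], and nothing enters at the left
    boundary. *)
Lemma label_count_row (k : nat) (i : 'I_n) (y : nat) : y <= n ->
  label_count k i.+1 y = label_count k i y + label_geq k (row_label i y).
Proof.
elim: y => [|y IHy] ltyn; first by rewrite !label_count0 row_label0.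
pose j := Ordinal ltyn; have := label_geq_propagate k i j.
rewrite (label_count_col k i j) (label_count_col k i.+1 j) /= IHy ?(ltnW ltyn) //=.
lia.
Qed.

(** By conservation H(x+1, y+1) - H(x, y) is the number of marked labels entering cell [(x, y)]. The
    top edge takes as many of them as it can carry, hence the minimum with [vedge P x y]. *)
Lemma label_count_min (k x y : nat) : x < n -> y < n ->
  label_count k x y.+1
  = minn (label_count k x y + vedge P x y) (label_count k x.+1 y.+1).
Proof.
move=> ltxn ltyn; pose i := Ordinal ltxn; pose j := Ordinal ltyn.
have := label_geq_propagate k i j.
have := label_count_col k i j; have := label_count_col k i.+1 j.
have := label_count_row k i (ltnW ltyn).
by rewrite /=; lia.
Qed.

Lemma label_count_step (k x y : nat) : x <= n -> y < n ->
  label_count k x y.+1 <= label_count k x y + vedge P x y.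
Proof.
move=> le_xn ltyn; pose j := Ordinal ltyn.
have := label_count_col k x j; have := col_label_isSome j le_xn.
by rewrite /= => <- ->; case: (col_label x j) => //= l; case: (k <= l); lia.
Qed.

Lemma label_count_last (k y : nat) :
  label_count k n y = \sum_(j < n | j < y) (k <= j).
Proof. by apply: eq_bigr => j _; rewrite col_label_last. Qed.

End Edges.

(** In the last column, the difference of the counts on two consecutive lines tells whether the
    label leaving the row between them is at least [k]; over all [k] this determines the label. *)
Lemma demazure_label_count (n : nat) (P Q : bpd n) :
    (forall k x, x <= n -> label_count P k x n = label_count Q k x n) ->
  demazure P =1 demazure Q.
Proof.
move=> eqPQ i; rewrite !demazure_row_label.
have eq_geq k : label_geq k (row_label P i n) = label_geq k (row_label Q i n).
  have := label_count_row P k i (leqnn n); have := label_count_row Q k i (leqnn n).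
  by rewrite !eqPQ //; [case: label_geq; case: label_geq; lia | apply: ltnW].
have sP : isSome (row_label P i n).
  by rewrite row_label_isSome ?hedge_last // => j; apply: col_label_isSome.
have sQ : isSome (row_label Q i n).
  by rewrite row_label_isSome ?hedge_last // => j; apply: col_label_isSome.
move: eq_geq sP sQ; case: row_label => // l; case: row_label => // l' eq_geq _ _.
congr Some; apply/val_inj/eqP; rewrite eqn_leq.
by have := eq_geq l; have := eq_geq l'; rewrite /= !leqnn => -> <-.
Qed.

Lemma demazure_le (n i a j b : nat) (P Q : bpd n) :
    i < a -> a < n -> j < b -> b < n ->
    (forall x y, ~~ ((i < x <= a) && (j <= y <= b)) -> vedge P x y = vedge Q x y) ->
    (forall x, i < x <= a ->
       \sum_(j <= t < b.+1) vedge P x t <= \sum_(j <= t < b.+1) vedge Q x t) ->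
    (forall x t, i <= x < a -> j <= t < b -> vedge Q x t <= vedge Q x.+1 t) ->
    (forall x y, i < x <= a -> j < y <= b ->
       \sum_(y <= t < b.+1) vedge Q a.+1 t <= \sum_(y <= t < b.+1) vedge Q x t) ->
  forall k x, x <= n -> label_count P k x n <= label_count Q k x n.
Proof.
move=> lt_ia lt_an lt_jb lt_bn v_out v_row v_col v_corner k.
apply: (path_min_le (v1 := fun x y => vedge P x y) (v2 := fun x y => vedge Q x y)
  lt_ia lt_an lt_jb lt_bn _ v_row v_col v_corner).
- by move=> x y /v_out ->.
- by move=> x; apply: label_count0.
- by move=> y _; rewrite !label_count_last.
- exact: label_count_step.
- by move=> x y ltxn ltyn; rewrite label_count_min // geq_minr.
- exact: label_count_min.
Qed.

Lemma cell_at_out (n : nat) (P : bpd n) (x y : nat) :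
  ~~ ((x < n) && (y < n)) -> cell_at P x y = Blank.
Proof.
rewrite /cell_at; case: insubP => // i ltxn _; case: insubP => // j ltyn _.
by rewrite ltxn ltyn.
Qed.

(** Neighbouring cells read the same value of [h] or [v], so the matching condition is automatic;
    what remains is that each cell has a tile and that the boundary values are right. *)
Lemma bpd_of_edges (n : nat) (h v : nat -> nat -> bool) :
    (forall x y, x < n -> y < n ->
       isSome (tile_decode (h x y, h x y.+1, (v x y, v x.+1 y)))) ->
    (forall x, x < n -> h x 0 = false /\ h x n = true) ->
    (forall y, y < n -> v 0 y = false /\ v n y = true) ->
  exists Q : bpd n, forall x y, x < n -> y < n ->
    tile_code (cell_at Q x y) = (h x y, h x y.+1, (v x y, v x.+1 y)).
Proof.
move=> okhv h0n v0n.
pose c (i j : 'I_n) := (h i j, h i j.+1, (v i j, v i.+1 j)).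
pose M : 'M[tile]_n := (\matrix_(i, j) odflt Blank (tile_decode (c i j)))%R.
have cM (i j : 'I_n) : tile_code (M i j) = c i j.
  rewrite mxE; have := okhv i j (ltn_ord i) (ltn_ord j); rewrite -/(c i j).
  by case: (c i j) => [[[] []] [[] []]].
have okM : is_bpd M.
  apply/and3P; split; apply/forallP => i; apply/forallP => j.
  - apply/forallP => j'; apply/implyP => /eqP Ej'.
    by have [_ -> _ _] := cM i j; have [-> _ _ _] := cM i j'; rewrite Ej'.
  - apply/forallP => j'; apply/implyP => /eqP Ej.
    by have [_ _ _ ->] := cM i j'; have [_ _ -> _] := cM j j'; rewrite Ej.
  have [-> -> -> ->] := cM i j.
  have [hi0 hin] := h0n i (ltn_ord i); have [vj0 vjn] := v0n j (ltn_ord j).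
  apply/and4P; split; apply/implyP => /eqP E.
  - by rewrite E.
  - by rewrite E.
  - by rewrite E hi0.
  - by rewrite E vj0.
exists (Bpd okM) => x y ltxn ltyn.
by have := cM (Ordinal ltxn) (Ordinal ltyn); rewrite -[M _ _]cell_atE.
Qed.

(** * Slides *)

Arguments hedge : simpl never.
Arguments vedge : simpl never.

Definition elbow (t : tile) : bool := (t == DownElbow) || (t == UpElbow).

Lemma straight_tile (t : tile) : ~~ elbow t ->
  meets_left t = meets_right t /\ meets_top t = meets_bottom t.
Proof. by case: t. Qed.

Lemma cell_edges (n : nat) (P : bpd n) (x y : nat) : x < n -> y < n ->
  [/\ meets_left (cell_at P x y) = hedge P x y,
      meets_right (cell_at P x y) = hedge P x y.+1,
      meets_top (cell_at P x y) = vedge P x y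
    & meets_bottom (cell_at P x y) = vedge P x.+1 y].
Proof. by move=> ltxn ltyn; case: (tile_code_cell_at P ltxn ltyn). Qed.

Lemma row_run (n : nat) (P : bpd n) (x y y' : nat) :
    x < n -> y <= y' -> y' <= n ->
    (forall t, y <= t < y' -> ~~ elbow (cell_at P x t)) ->
  hedge P x y' = hedge P x y.
Proof.
move=> ltxn; elim: y' => [|y' IHy] le_yy' le_y'n Hne; first by have -> : y = 0 by lia.
have [->//|ne] := eqVneq y y'.+1.
rewrite -IHy; [|lia|lia|by move=> t ?; apply: Hne; lia].
have [<- <- _ _] := cell_edges P ltxn le_y'n.
by have [|->] := @straight_tile (cell_at P x y'); first by apply: Hne; lia.
Qed.

Lemma col_run (n : nat) (P : bpd n) (x x' y : nat) :
    y < n -> x <= x' -> x' <= n ->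
    (forall t, x <= t < x' -> ~~ elbow (cell_at P t y)) ->
  vedge P x' y = vedge P x y.
Proof.
move=> ltyn; elim: x' => [|x' IHx] le_xx' le_x'n Hne; first by have -> : x = 0 by lia.
have [->//|ne] := eqVneq x x'.+1.
rewrite -IHx; [|lia|lia|by move=> t ?; apply: Hne; lia].
have [_ _ <- <-] := cell_edges P le_x'n ltyn.
by have [|_ ->] := @straight_tile (cell_at P x' y); first by apply: Hne; lia.
Qed.

Definition corner (i a j b x y : nat) : bool :=
  ((x == i) || (x == a)) && ((y == j) || (y == b)).
Definition box (i a j b x y : nat) : bool := (i <= x <= a) && (j <= y <= b).
(** The toggled edges form the closed loop through the border cells of the rectangle. Edge [y] lies
    west of cell [y], which is why column [j] itself is left out, and likewise row [i] in
    [flip_v]. *)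
Definition flip_h (i a j b x y : nat) : bool :=
  ((x == i) || (x == a)) && (j < y <= b).
Definition flip_v (i a j b x y : nat) : bool :=
  ((y == j) || (y == b)) && (i < x <= a).

(** A border cell that is not a corner has two opposite edges toggled, and a straight tile stays
    straight under this. So only the four corners need a check; no boundary edge of the grid is
    toggled. *)
Lemma flip_bpd (n i a j b : nat) (P : bpd n) :
    i < a -> a < n -> j < b -> b < n ->
    (forall x y, box i a j b x y -> ~~ corner i a j b x y ->
       ~~ elbow (cell_at P x y)) ->
    (forall x y, corner i a j b x y ->
       isSome (tile_decode
         (hedge P x y (+) flip_h i a j b x y, hedge P x y.+1 (+) flip_h i a j b x y.+1,
         (vedge P x y (+) flip_v i a j b x y, vedge P x.+1 y (+) flip_v i a j b x.+1 y)))) ->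
  exists Q : bpd n, [/\
    forall x y, x < n -> y < n -> tile_code (cell_at Q x y) =
         (hedge P x y (+) flip_h i a j b x y, hedge P x y.+1 (+) flip_h i a j b x y.+1,
         (vedge P x y (+) flip_v i a j b x y, vedge P x.+1 y (+) flip_v i a j b x.+1 y)),
    forall x y, vedge Q x y = vedge P x y (+) flip_v i a j b x y,
    forall x y, ~~ box i a j b x y -> cell_at Q x y = cell_at P x y
  & forall x y, box i a j b x y -> ~~ corner i a j b x y ->
       ~~ elbow (cell_at Q x y)].
Proof.
move=> lt_ia lt_an lt_jb lt_bn Hne Hcorner.
pose h x y := hedge P x y (+) flip_h i a j b x y.
pose v x y := vedge P x y (+) flip_v i a j b x y.
have flip_out x y : ~~ box i a j b x y ->
    [/\ h x y = hedge P x y, h x y.+1 = hedge P x y.+1, v x y = vedge P x y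
      & v x.+1 y = vedge P x.+1 y].
  by rewrite /box /h /v /flip_h /flip_v; split; lia.
have flip_in x y : x < n -> y < n -> box i a j b x y -> ~~ corner i a j b x y ->
    h x y = h x y.+1 /\ v x y = v x.+1 y.
  move=> ltxn ltyn inb ninc; have [El Et] := straight_tile (Hne x y inb ninc).
  have [Hl Hr Ht Hb] := cell_edges P ltxn ltyn; rewrite /h /v.
  have -> : flip_h i a j b x y.+1 = flip_h i a j b x y.
    by move: inb ninc; rewrite /box /corner /flip_h; lia.
  have -> : flip_v i a j b x.+1 y = flip_v i a j b x y.
    by move: inb ninc; rewrite /box /corner /flip_v; lia.
  by rewrite -Hl El Hr -Ht Et Hb.
have [|x ltxn|y ltyn|Q codeQ] := @bpd_of_edges n h v.
- move=> x y ltxn ltyn.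
  have [inc|ninc] := boolP (corner i a j b x y); first exact: Hcorner.
  have [inb|/flip_out[-> -> -> ->]] := boolP (box i a j b x y).
    have [<- <-] := flip_in x y ltxn ltyn inb ninc.
    by case: (h x y); case: (v x y).
  by rewrite -tile_code_cell_at // tile_codeK.
- by split; rewrite /h /flip_h ?hedge_last //=; lia.
- by split; rewrite /v /flip_v ?vedge_last //=; lia.
exists Q; split=> [//|[|x] y|x y out|x y inb ninc].
- by rewrite /vedge /flip_v ltn0 andbF.
- have [/andP[ltxn ltyn]|out] := boolP ((x < n) && (y < n)).
    by have [_ _ _ <-] := cell_edges Q ltxn ltyn; have [_ _ _ ->] := codeQ x y ltxn ltyn.
  rewrite /vedge !cell_at_out // /flip_v /=.
  by apply/esym/negbTE; apply: contra out; lia.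
  have [/andP[ltxn ltyn]|out'] := boolP ((x < n) && (y < n)); last by rewrite !cell_at_out.
  apply: (pcan_inj tile_codeK); rewrite codeQ // tile_code_cell_at //.
  by have [-> -> -> ->] := flip_out x y out.
have [ltxn ltyn] : x < n /\ y < n by move: inb; rewrite /box; lia.
have [Eh Ev] := flip_in x y ltxn ltyn inb ninc.
have := codeQ x y ltxn ltyn; rewrite -/(h x y) -/(v x y) -/(h x y.+1) -/(v x.+1 y) -Eh -Ev.
by rewrite /tile_code; case: cell_at => // -[<-].
Qed.

(** This is the local change common to all moves. A blank cell at [(a, b)] gives a droop; a downward
    elbow there, turned into a crossing, gives the part of a K-theoretic droop cut off by its middle
    elbow. *)
Record slide (n i a j b : nat) (P Q : bpd n) : Prop := Slide {
  slide_ia : i < a; slide_an : a < n; slide_jb : j < b; slide_bn : b < n;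
  slide_Pij : cell_at P i j = DownElbow; slide_Qij : cell_at Q i j = Blank;
  slide_Pib : cell_at P i b = Horizontal; slide_Qib : cell_at Q i b = DownElbow;
  slide_Paj : cell_at P a j = Vertical; slide_Qaj : cell_at Q a j = DownElbow;
  slide_ab : cell_at P a b = Blank /\ cell_at Q a b = UpElbow
             \/ cell_at P a b = DownElbow /\ cell_at Q a b = Crossing;
  slide_in : forall x y, box i a j b x y -> ~~ corner i a j b x y ->
    ~~ elbow (cell_at P x y) /\ ~~ elbow (cell_at Q x y);
  slide_v : forall x y, vedge Q x y = vedge P x y (+) flip_v i a j b x y;
  slide_out : forall x y, ~~ box i a j b x y -> cell_at Q x y = cell_at P x y }.

Lemma cornerP (i a j b x y : nat) : corner i a j b x y ->
  [\/ x = i /\ y = j, x = i /\ y = b, x = a /\ y = j | x = a /\ y = b].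
Proof.
case/andP=> /orP[] /eqP-> /orP[] /eqP->;
  by [constructor 1|constructor 2|constructor 3|constructor 4].
Qed.

Lemma flip_corners (i a j b : nat) : i < a -> j < b ->
  let fl x y := (flip_h i a j b x y, flip_h i a j b x y.+1,
                 (flip_v i a j b x y, flip_v i a j b x.+1 y)) in
  [/\ fl i j = (false, true, (false, true)), fl i b = (true, false, (false, true)),
      fl a j = (false, true, (true, false)) & fl a b = (true, false, (true, false))].
Proof.
by move=> lt_ia lt_jb fl; rewrite /fl /flip_h /flip_v; split;
  congr (_, _, (_, _)); lia.
Qed.

Lemma border_row (i a j b t : nat) : i < a -> j < t < b ->
  [/\ box i a j b i t, ~~ corner i a j b i t, box i a j b a t & ~~ corner i a j b a t].
Proof. by rewrite /box /corner => *; split; lia. Qed.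

Lemma border_col (i a j b t : nat) : j < b -> i < t < a ->
  [/\ box i a j b t j, ~~ corner i a j b t j, box i a j b t b & ~~ corner i a j b t b].
Proof. by rewrite /box /corner => *; split; lia. Qed.

Lemma border_straight (n i a j b : nat) (P : bpd n) :
    i < a -> a < n -> j < b -> b < n ->
    (forall x y, box i a j b x y -> ~~ corner i a j b x y -> ~~ elbow (cell_at P x y)) ->
  [/\ meets_left (cell_at P i b) = meets_right (cell_at P i j),
      meets_left (cell_at P a b) = meets_right (cell_at P a j),
      meets_top (cell_at P a j) = meets_bottom (cell_at P i j)
    & meets_top (cell_at P a b) = meets_bottom (cell_at P i b)].
Proof.
move=> lt_ia lt_an lt_jb lt_bn ne.
have [lt_in lt_jn] : i < n /\ j < n by lia.
have [_ -> _ ->] := cell_edges P lt_in lt_jn.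
have [-> _ _ ->] := cell_edges P lt_in lt_bn.
have [_ -> -> _] := cell_edges P lt_an lt_jn.
have [-> _ -> _] := cell_edges P lt_an lt_bn.
split.
- by apply: row_run => //; [exact: ltnW | move=> t /(border_row lt_ia)[ib nc _ _]; apply: ne].
- by apply: row_run => //; [exact: ltnW | move=> t /(border_row lt_ia)[_ _ ib nc]; apply: ne].
- by apply: col_run => //; [exact: ltnW | move=> t /(border_col lt_jb)[ib nc _ _]; apply: ne].
- by apply: col_run => //; [exact: ltnW | move=> t /(border_col lt_jb)[_ _ ib nc]; apply: ne].
Qed.

Lemma box_corners (i a j b : nat) : i < a -> j < b ->
  [/\ box i a j b i j, box i a j b i b, box i a j b a j & box i a j b a b].
Proof. by rewrite /box => *; split; lia. Qed.

(** Along the elbow-free sides the edges of the corners [(i, j)] and [(a, b)] propagate to the two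
    other corners and force their tiles; all four corners then admit the toggle. *)
Lemma slide_forward (n i a j b : nat) (P : bpd n) :
    i < a -> a < n -> j < b -> b < n ->
    cell_at P i j = DownElbow ->
    cell_at P a b = Blank \/ cell_at P a b = DownElbow ->
    (forall x y, box i a j b x y -> (x, y) != (i, j) -> (x, y) != (a, b) ->
       ~~ elbow (cell_at P x y)) ->
  exists Q, slide i a j b P Q.
Proof.
move=> lt_ia lt_an lt_jb lt_bn Pij Pab Hne.
have [lt_in lt_jn] : i < n /\ j < n by lia.
have ne x y : box i a j b x y -> ~~ corner i a j b x y -> ~~ elbow (cell_at P x y).
  by move=> inb; rewrite /corner => ninc; apply: Hne => //; rewrite xpair_eqE; lia.
have [lib rib bib tib] := border_straight lt_ia lt_an lt_jb lt_bn ne.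
have [bij bxib bxaj _] := box_corners lt_ia lt_jb.
have neib : ~~ elbow (cell_at P i b).
  by apply: Hne; rewrite // xpair_eqE ?(gtn_eqF lt_jb) ?(ltn_eqF lt_ia) ?andbF.
have neaj : ~~ elbow (cell_at P a j).
  by apply: Hne; rewrite // xpair_eqE ?(ltn_eqF lt_jb) ?(gtn_eqF lt_ia) ?andbF.
have Pib : cell_at P i b = Horizontal.
  by move: lib tib neib; rewrite Pij; case: Pab => ->; case: cell_at.
have Paj : cell_at P a j = Vertical.
  by move: bib rib neaj; rewrite Pij; case: Pab => ->; case: cell_at.
have [flij flib flaj flab] := flip_corners lt_ia lt_jb.
have [x y /cornerP[] [-> ->]|Q [codeQ vQ outQ inQ]] := flip_bpd lt_ia lt_an lt_jb lt_bn ne.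
- by have [<- <- <- <-] := cell_edges P lt_in lt_jn; case: flij => -> -> -> ->; rewrite Pij.
- by have [<- <- <- <-] := cell_edges P lt_in lt_bn; case: flib => -> -> -> ->; rewrite Pib.
- by have [<- <- <- <-] := cell_edges P lt_an lt_jn; case: flaj => -> -> -> ->; rewrite Paj.
- have [<- <- <- <-] := cell_edges P lt_an lt_bn; case: flab => -> -> -> ->.
  by case: Pab => ->.
exists Q; split=> //.
- have := codeQ i j lt_in lt_jn; case: flij => -> -> -> ->.
  by have [<- <- <- <-] := cell_edges P lt_in lt_jn; rewrite Pij; case: cell_at.
- have := codeQ i b lt_in lt_bn; case: flib => -> -> -> ->.
  by have [<- <- <- <-] := cell_edges P lt_in lt_bn; rewrite Pib; case: cell_at.
- have := codeQ a j lt_an lt_jn; case: flaj => -> -> -> ->.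
  by have [<- <- <- <-] := cell_edges P lt_an lt_jn; rewrite Paj; case: cell_at.
- have := codeQ a b lt_an lt_bn; case: flab => -> -> -> ->.
  have [<- <- <- <-] := cell_edges P lt_an lt_bn.
  by case: Pab => ->; case: cell_at => // _; [left | right].
- by move=> x y inb ninc; split; [apply: ne | apply: inQ].
Qed.

(** Toggling is an involution, so the same flip undoes a slide. The two downward elbows force a
    blank tile at [(i, j)] and make the left and top edges of [(a, b)] met. *)
Lemma slide_backward (n i a j b : nat) (Q : bpd n) :
    i < a -> a < n -> j < b -> b < n ->
    cell_at Q i b = DownElbow -> cell_at Q a j = DownElbow ->
    cell_at Q a b != DownElbow ->
    (forall x y, box i a j b x y -> (x, y) != (i, b) -> (x, y) != (a, j) ->
       (x, y) != (a, b) -> ~~ elbow (cell_at Q x y)) ->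
  exists P, slide i a j b P Q.
Proof.
move=> lt_ia lt_an lt_jb lt_bn Qib Qaj Qab Hne.
have [lt_in lt_jn] : i < n /\ j < n by lia.
have ne x y : box i a j b x y -> ~~ corner i a j b x y -> ~~ elbow (cell_at Q x y).
  by move=> inb; rewrite /corner => ninc; apply: Hne => //; rewrite xpair_eqE; lia.
have [lib rib bib tib] := border_straight lt_ia lt_an lt_jb lt_bn ne.
have [bij bxib bxaj _] := box_corners lt_ia lt_jb.
have neij : ~~ elbow (cell_at Q i j).
  by apply: Hne; rewrite // xpair_eqE ?(ltn_eqF lt_jb) ?(ltn_eqF lt_ia) ?andbF.
have Qij : cell_at Q i j = Blank.
  by move: lib bib neij; rewrite Qib Qaj; case: cell_at.
have {}Qab : cell_at Q a b = UpElbow \/ cell_at Q a b = Crossing.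
  by move: rib tib Qab; rewrite Qib Qaj; case: cell_at => //; [left | right].
have [flij flib flaj flab] := flip_corners lt_ia lt_jb.
have [x y /cornerP[] [-> ->]|P [codeP vP outP inP]] := flip_bpd lt_ia lt_an lt_jb lt_bn ne.
- by have [<- <- <- <-] := cell_edges Q lt_in lt_jn; case: flij => -> -> -> ->; rewrite Qij.
- by have [<- <- <- <-] := cell_edges Q lt_in lt_bn; case: flib => -> -> -> ->; rewrite Qib.
- by have [<- <- <- <-] := cell_edges Q lt_an lt_jn; case: flaj => -> -> -> ->; rewrite Qaj.
- have [<- <- <- <-] := cell_edges Q lt_an lt_bn; case: flab => -> -> -> ->.
  by case: Qab => ->.
exists P; split=> //.
- have := codeP i j lt_in lt_jn; case: flij => -> -> -> ->.
  by have [<- <- <- <-] := cell_edges Q lt_in lt_jn; rewrite Qij; case: cell_at.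
- have := codeP i b lt_in lt_bn; case: flib => -> -> -> ->.
  by have [<- <- <- <-] := cell_edges Q lt_in lt_bn; rewrite Qib; case: cell_at.
- have := codeP a j lt_an lt_jn; case: flaj => -> -> -> ->.
  by have [<- <- <- <-] := cell_edges Q lt_an lt_jn; rewrite Qaj; case: cell_at.
- have := codeP a b lt_an lt_bn; case: flab => -> -> -> ->.
  have [<- <- <- <-] := cell_edges Q lt_an lt_bn.
  by case: Qab => ->; case: cell_at => // _; [left | right].
- by move=> x y inb ninc; split; [apply: inP | apply: ne].
- by move=> x y; rewrite vP addbK.
- by move=> x y /outP->.
Qed.

(** * Effect of a slide on vertical edges and elbows *)

Section Slide.
Variables (n i a j b : nat) (P Q : bpd n).
Hypothesis PQ : slide i a j b P Q.

Lemma slide_vedge_in (x : nat) : i < x <= a ->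
  [/\ vedge P x j = true, vedge Q x j = false, vedge P x b = false & vedge Q x b = true].
Proof.
case: PQ => lt_ia lt_an lt_jb lt_bn Pij Qij Pib Qib Paj Qaj ab ins vQ out le_x.
have lt_in := ltn_trans lt_ia lt_an; have lt_jn := ltn_trans lt_jb lt_bn.
have [lt_ix le_xa] := andP le_x.
have Pxj : vedge P x j.
  have [_ _ _] := cell_edges P lt_in lt_jn; rewrite Pij => /= e.
  rewrite (@col_run _ _ i.+1) -?e ?(leq_trans le_xa (ltnW lt_an)) // => t /andP[lt_it lt_tx].
  have lt_ta := leq_trans lt_tx le_xa.
  have [|ib nc _ _] := @border_col i a j b t lt_jb; first by rewrite lt_it lt_ta.
  by have [] := ins t j ib nc.
have Pxb : vedge P x b = false.
  have [_ _ _] := cell_edges P lt_in lt_bn; rewrite Pib => /= e.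
  rewrite (@col_run _ _ i.+1) -?e ?(leq_trans le_xa (ltnW lt_an)) // => t /andP[lt_it lt_tx].
  have lt_ta := leq_trans lt_tx le_xa.
  have [|_ _ ib nc] := @border_col i a j b t lt_jb; first by rewrite lt_it lt_ta.
  by have [] := ins t b ib nc.
by rewrite !vQ Pxj Pxb /flip_v lt_ix le_xa !eqxx orbT.
Qed.

Lemma slide_vedge_out (x y : nat) : ~~ (i < x <= a) || (y != j) && (y != b) ->
  vedge Q x y = vedge P x y.
Proof.
rewrite (slide_v PQ) -negb_or -negb_and /flip_v andbC => /negbTE->.
by rewrite addbF.
Qed.

(** On each line that it affects, a slide moves one vertical edge from column [j] to column [b], and
    both columns lie in the window of summation. *)
Lemma slide_row_sum (c x : nat) : b <= c ->
  \sum_(j <= t < c.+1) vedge P x t = \sum_(j <= t < c.+1) vedge Q x t.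
Proof.
move=> le_bc; have lt_jb := slide_jb PQ.
have [le_x|nle_x] := boolP (i < x <= a); last first.
  by apply: eq_bigr => t _; rewrite slide_vedge_out ?nle_x.
have split_sum (F : nat -> nat) : \sum_(j <= t < c.+1) F t =
    F j + (\sum_(j.+1 <= t < b) F t + (F b + \sum_(b.+1 <= t < c.+1) F t)).
  have lt_bc : b < c.+1 by [].
  have lt_jc : j < c.+1 := ltn_trans lt_jb lt_bc.
  by rewrite (big_ltn lt_jc) (big_cat_nat lt_jb (ltnW lt_bc)) /= (big_ltn lt_bc).
rewrite !split_sum; have [-> -> -> ->] := slide_vedge_in le_x.
rewrite !(big_nat _ _ j.+1) !(big_nat _ _ b.+1) /=.
have eqL : \sum_(j.+1 <= t < b | j < t < b) vedge P x t
         = \sum_(j.+1 <= t < b | j < t < b) vedge Q x t.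
  by apply: eq_bigr => t le_t; rewrite slide_vedge_out //; lia.
have eqR : \sum_(b.+1 <= t < c.+1 | b < t < c.+1) vedge P x t
         = \sum_(b.+1 <= t < c.+1 | b < t < c.+1) vedge Q x t.
  by apply: eq_bigr => t le_t; rewrite slide_vedge_out //; lia.
by rewrite eqL eqR; lia.
Qed.

Lemma slide_elbows (x y : nat) :
  [/\ (cell_at P x y == DownElbow) =
        if box i a j b x y then ((x, y) == (i, j)) || ((x, y) == (a, b)) && (cell_at P a b == DownElbow)
        else cell_at P x y == DownElbow,
      (cell_at P x y == UpElbow) =
        if box i a j b x y then false else cell_at P x y == UpElbow,
      (cell_at Q x y == DownElbow) =
        if box i a j b x y then ((x, y) == (i, b)) || ((x, y) == (a, j))
        else cell_at P x y == DownElbow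
    & (cell_at Q x y == UpElbow) =
        if box i a j b x y then ((x, y) == (a, b)) && (cell_at P a b == Blank)
        else cell_at P x y == UpElbow].
Proof.
case: PQ => lt_ia lt_an lt_jb lt_bn Pij Qij Pib Qib Paj Qaj ab ins vQ out.
case: ifP => [inb|/negbT outb]; last by rewrite out.
have [/cornerP[] [-> ->]|ninc] := boolP (corner i a j b x y); rewrite !xpair_eqE.
- by rewrite Pij Qij !eqxx ?(ltn_eqF lt_ia) ?(ltn_eqF lt_jb).
- by rewrite Pib Qib !eqxx ?(ltn_eqF lt_ia) ?(gtn_eqF lt_jb).
- by rewrite Paj Qaj !eqxx ?(gtn_eqF lt_ia) ?(ltn_eqF lt_jb) ?orbT.
- rewrite !eqxx ?(gtn_eqF lt_ia) ?(gtn_eqF lt_jb) /=.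
  by case: ab => -[-> ->].
have [neP neQ] := ins x y inb ninc.
have -> : (x == i) && (y == j) = false by move: ninc; rewrite /corner; lia.
have -> : (x == i) && (y == b) = false by move: ninc; rewrite /corner; lia.
have -> : (x == a) && (y == j) = false by move: ninc; rewrite /corner; lia.
have -> : (x == a) && (y == b) = false by move: ninc; rewrite /corner; lia.
by move: neP neQ; rewrite /elbow !negb_or => /andP[/negbTE-> /negbTE->] /andP[/negbTE-> /negbTE->].
Qed.

End Slide.

(** * Monotonicity of edges and the south-east corner condition *)

Section Monotone.
Variables (n : nat) (T : bpd n).

Lemma vedge_le (x x' y : nat) : y < n -> x <= x' -> x' <= n ->
    (forall r, x <= r < x' -> cell_at T r y != UpElbow) ->
  vedge T x y <= vedge T x' y.
Proof.
move=> ltyn; elim: x' => [|x' IHx] le_xx' le_x'n Hne; first by have -> : x = 0 by lia.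
have [->//|ne] := eqVneq x x'.+1; have le_xx : x <= x' by lia.
apply: leq_trans (IHx le_xx (ltnW le_x'n) _) _.
  by move=> r /andP[le_xr lt_rx]; apply: Hne; rewrite le_xr ltnW.
have [_ _ <- <-] := cell_edges T le_x'n ltyn.
by have := Hne x'; rewrite le_xx leqnn => /(_ isT); case: cell_at.
Qed.

Lemma vedge_ge (x x' y : nat) : y < n -> x <= x' -> x' <= n ->
    (forall r, x <= r < x' -> cell_at T r y != DownElbow) ->
  vedge T x' y <= vedge T x y.
Proof.
move=> ltyn; elim: x' => [|x' IHx] le_xx' le_x'n Hne; first by have -> : x = 0 by lia.
have [->//|ne] := eqVneq x x'.+1; have le_xx : x <= x' by lia.
apply: leq_trans _ (IHx le_xx (ltnW le_x'n) _).
  have [_ _ <- <-] := cell_edges T le_x'n ltyn.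
  by have := Hne x'; rewrite le_xx leqnn => /(_ isT); case: cell_at.
by move=> r /andP[le_xr lt_rx]; apply: Hne; rewrite le_xr ltnW.
Qed.

Lemma hedge_le (x y y' : nat) : x < n -> y <= y' -> y' <= n ->
    (forall t, y <= t < y' -> cell_at T x t != UpElbow) ->
  hedge T x y <= hedge T x y'.
Proof.
move=> ltxn; elim: y' => [|y' IHy] le_yy' le_y'n Hne; first by have -> : y = 0 by lia.
have [->//|ne] := eqVneq y y'.+1; have le_yy : y <= y' by lia.
apply: leq_trans (IHy le_yy (ltnW le_y'n) _) _.
  by move=> r /andP[le_yr lt_ry]; apply: Hne; rewrite le_yr ltnW.
have [<- <- _ _] := cell_edges T ltxn le_y'n.
by have := Hne y'; rewrite le_yy leqnn => /(_ isT); case: cell_at.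
Qed.

Lemma hedge_ge (x y y' : nat) : x < n -> y <= y' -> y' <= n ->
    (forall t, y <= t < y' -> cell_at T x t != DownElbow) ->
  hedge T x y' <= hedge T x y.
Proof.
move=> ltxn; elim: y' => [|y' IHy] le_yy' le_y'n Hne; first by have -> : y = 0 by lia.
have [->//|ne] := eqVneq y y'.+1; have le_yy : y <= y' by lia.
apply: leq_trans _ (IHy le_yy (ltnW le_y'n) _).
  have [<- <- _ _] := cell_edges T ltxn le_y'n.
  by have := Hne y'; rewrite le_yy leqnn => /(_ isT); case: cell_at.
by move=> r /andP[le_yr lt_ry]; apply: Hne; rewrite le_yr ltnW.
Qed.

Lemma row_flux (x y y' : nat) : x < n -> y <= y' -> y' <= n ->
  \sum_(y <= t < y') vedge T x.+1 t + hedge T x y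
  = \sum_(y <= t < y') vedge T x t + hedge T x y'.
Proof.
move=> ltxn; elim: y' => [|y' IHy] le_yy' le_y'n.
  by rewrite (_ : y = 0) ?big_geq //; lia.
have [->|ne] := eqVneq y y'.+1; first by rewrite !big_geq.
have le_yy : y <= y' by lia.
rewrite !big_nat_recr //=; have := IHy le_yy (ltnW le_y'n).
have [] := cell_edges T ltxn le_y'n.
by case: cell_at => /= <- <- <- <-; lia.
Qed.

(* The conditions under which [path_min_le] applies to the rectangle
   [i, a] x [j, b]. *)
Definition se_corner (i a j b : nat) : Prop :=
  (forall x y, i <= x < a -> j <= y < b -> cell_at T x y != UpElbow) /\
  (forall x y, i < x <= a -> j < y <= b ->
     \sum_(y <= t < b.+1) vedge T a.+1 t <= \sum_(y <= t < b.+1) vedge T x t).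

(** Without downward elbows a met edge stays met on the way up its column, so the sums compare term
    by term; in column [b] the edge below [(a, b)] is empty. *)
Lemma se_corner_cols (i a j b : nat) : a < n -> b < n ->
    (forall x y, i <= x < a -> j <= y < b -> cell_at T x y != UpElbow) ->
    (forall x y, i < x <= a -> j < y < b -> cell_at T x y != DownElbow) ->
    ~~ meets_bottom (cell_at T a b) ->
  se_corner i a j b.
Proof.
move=> lt_an lt_bn noU noD; have [_ _ _ -> /negbTE vab] := cell_edges T lt_an lt_bn.
split=> // x y le_x le_y; apply: leq_sum_nat => t le_t.
have [->|ne_tb] := eqVneq t b; first by rewrite vab.
by apply: vedge_ge => [|||r le_r]; [lia|lia|lia|apply: noD; lia].
Qed.

(** This criterion allows downward elbows in row [a]. The sums are compared line by line through
    [row_flux]: in a row without downward elbows a horizontal pipe can end but not start on the way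
    east, and in row [a] the right edge of [(a, b)] is empty. *)
Lemma se_corner_rows (i a j b : nat) : a < n -> b < n ->
    (forall x y, i <= x < a -> j <= y < b -> cell_at T x y != UpElbow) ->
    (forall x y, i < x < a -> j < y <= b -> cell_at T x y != DownElbow) ->
    ~~ meets_right (cell_at T a b) ->
  se_corner i a j b.
Proof.
move=> lt_an lt_bn noU noD; have [_ -> _ _ /negbTE hab] := cell_edges T lt_an lt_bn.
split=> // x y le_x le_y.
have step r : x <= r <= a ->
    \sum_(y <= t < b.+1) vedge T r.+1 t <= \sum_(y <= t < b.+1) vedge T r t.
  move=> le_r; have lt_rn : r < n by lia.
  have le_yb : y <= b.+1 by lia.
  suff : hedge T r b.+1 <= hedge T r y by have := row_flux lt_rn le_yb lt_bn; lia.
  have [->|ne_ra] := eqVneq r a; first by rewrite hab.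
  by apply: hedge_ge => // t le_t; apply: noD; lia.
have [d Ea] : exists d, a = x + d by exists (a - x); lia.
have {}step r : r <= d ->
    \sum_(y <= t < b.+1) vedge T (x + r).+1 t <= \sum_(y <= t < b.+1) vedge T (x + r) t.
  by move=> le_r; apply: step; lia.
rewrite Ea; elim: d step {Ea} => [|d IHd] step; first by have := step 0; rewrite addn0; apply.
apply: leq_trans (step d.+1 (leqnn _)) _; rewrite addnS; apply: IHd => r le_rd.
by apply: step; apply: leqW.
Qed.

End Monotone.

(** Sums over the window [[i, A] x [j, B]] agree on each line, so [demazure_le] applies in both
    directions, each time with the corner condition of the BPD on the larger side. For a K-theoretic
    droop the window is the whole rectangle of the move, which exceeds that of the slide. *)
Lemma slide_demazure (n i a j b A B : nat) (P Q : bpd n) :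
    slide i a j b P Q -> a <= A -> A < n -> b <= B -> B < n ->
  se_corner P i A j B -> se_corner Q i A j B -> demazure P =1 demazure Q.
Proof.
move=> PQ le_aA lt_An le_bB lt_Bn [noUP cP] [noUQ cQ].
have [lt_ia lt_jb] := (slide_ia PQ, slide_jb PQ).
have lt_iA := leq_trans lt_ia le_aA; have lt_jB := leq_trans lt_jb le_bB.
have col (T : bpd n) : (forall x y, i <= x < A -> j <= y < B -> cell_at T x y != UpElbow) ->
    forall x t, i <= x < A -> j <= t < B -> vedge T x t <= vedge T x.+1 t.
  move=> noU x t le_x le_t; apply: vedge_le => [|||r le_r]; [lia|lia|lia|].
  by rewrite (_ : r = x) ?noU //; lia.
have out x y : ~~ ((i < x <= A) && (j <= y <= B)) -> vedge Q x y = vedge P x y.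
  by move=> nin; apply: (slide_vedge_out PQ); lia.
apply: demazure_label_count => k x le_xn; apply/eqP; rewrite eqn_leq; apply/andP; split.
- apply: (demazure_le lt_iA lt_An lt_jB lt_Bn) => // [x' y /out->//|x' le_x'|].
  + by rewrite (slide_row_sum PQ).
  + exact: col.
- apply: (demazure_le lt_iA lt_An lt_jB lt_Bn) => // [x' le_x'|].
  + by rewrite (slide_row_sum PQ).
  + exact: col.
Qed.

(** * Elbows before and after a move, and invariance of the Demazure product *)

Definition elbows_at (n : nat) (P : bpd n) (i a j b : nat) (D U : seq (nat * nat)) : Prop :=
  forall x y, box i a j b x y ->
    (cell_at P x y == DownElbow) = ((x, y) \in D) /\
    (cell_at P x y == UpElbow) = ((x, y) \in U).

Lemma droop_elbows (n i a j b : nat) (P Q : bpd n) :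
    slide i a j b P Q -> cell_at P a b = Blank ->
  elbows_at P i a j b [:: (i, j)] [::]
  /\ elbows_at Q i a j b [:: (a, j); (i, b)] [:: (a, b)].
Proof.
move=> PQ Pab; split=> x y inb; have := slide_elbows PQ x y; rewrite inb Pab !inE.
  by case=> -> -> _ _; rewrite andbF orbF.
by case=> _ _ -> ->; rewrite andbT orbC.
Qed.

(** One implication serves to apply the move, the other to recognise the move that an inverse slide
    undoes. *)
Lemma kdroop1_elbows (n i a j j' b : nat) (P Q : bpd n) :
    slide i a j j' P Q -> cell_at P a j' = DownElbow -> j' < b ->
  elbows_at P i a j b [:: (i, j); (a, j')] [:: (a, b)]
  <-> elbows_at Q i a j b [:: (a, j); (i, j')] [:: (a, b)].
Proof.
move=> PQ Paj' lt_j'b; have [lt_ia lt_jj'] := (slide_ia PQ, slide_jb PQ).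
have eqs x y : box i a j b x y ->
    [/\ box i a j j' x y = (y <= j'), (x, y) == (a, b) -> ~~ (y <= j'),
        ((x, y) == (a, j')) || ((x, y) == (i, j')) -> y <= j'
      & ((x, y) == (i, j)) || ((x, y) == (a, j)) -> y <= j'].
  by rewrite /box !xpair_eqE; split; lia.
split=> H x y inb; have := slide_elbows PQ x y; rewrite Paj' eqxx !andbT !andbF.
all: have [-> ab ij' ij] := eqs x y inb; have := H x y inb; rewrite !inE.
(* What remains is propositional in the equalities with the named cells and in the position of [y]
   relative to [j']. *)
all: move: ab ij' ij.
all: move: (cell_at P x y == DownElbow) (cell_at P x y == UpElbow) => pD pU.
all: move: (cell_at Q x y == DownElbow) (cell_at Q x y == UpElbow) => qD qU.
all: move: (_ == (a, b)) (_ == (a, j')) (_ == (i, j')) (_ == (i, j)) (_ == (a, j)) (y <= j').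
all: move=> ab aj' ij' ij aj [] h1 h2 h3 [-> ->] [? ? ? ?]; split; lia.
Qed.

Lemma kdroop2_elbows (n i i' a j b : nat) (P Q : bpd n) :
    slide i i' j b P Q -> cell_at P i' b = DownElbow -> i' < a ->
    elbows_at P i a j b [:: (i, j); (i', b)] [:: (a, b)] ->
  elbows_at Q i a j b [:: (i', j); (i, b)] [:: (a, b)].
Proof.
move=> PQ Pi'b lt_i'a; have [lt_ii' lt_jb] := (slide_ia PQ, slide_jb PQ).
have eqs x y : box i a j b x y ->
    [/\ box i i' j b x y = (x <= i'), (x, y) == (a, b) -> ~~ (x <= i'),
        ((x, y) == (i', b)) || ((x, y) == (i', j)) -> x <= i'
      & ((x, y) == (i, j)) || ((x, y) == (i, b)) -> x <= i'].
  by rewrite /box !xpair_eqE; split; lia.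
move=> H x y inb; have := slide_elbows PQ x y; rewrite Pi'b eqxx !andbT !andbF.
have [-> ab ij' ij] := eqs x y inb; have := H x y inb; rewrite !inE.
move: ab ij' ij.
move: (cell_at P x y == DownElbow) (cell_at P x y == UpElbow) => pD pU.
move: (cell_at Q x y == DownElbow) (cell_at Q x y == UpElbow) => qD qU.
move: (_ == (a, b)) (_ == (i', b)) (_ == (i', j)) (_ == (i, j)) (_ == (i, b)) (x <= i').
by move=> ab aj' ij' ij aj [] h1 h2 h3 [-> ->] [? ? ? ?]; split; lia.
Qed.

Lemma elbows_at_notin (n i a j b x y : nat) (P : bpd n) (D U : seq (nat * nat)) :
    elbows_at P i a j b D U -> box i a j b x y ->
  ((x, y) \notin D -> cell_at P x y != DownElbow)
  /\ ((x, y) \notin U -> cell_at P x y != UpElbow).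
Proof. by move=> H inb; have [-> ->] := H x y inb. Qed.

Lemma elbows_at_se_corner_cols (n i a j b : nat) (T : bpd n) (D U : seq (nat * nat)) :
    i < a -> a < n -> j < b -> b < n -> elbows_at T i a j b D U ->
    (forall x y, (x, y) \in U -> (x, y) = (a, b)) ->
    (forall x y, (x, y) \in D -> [\/ x = i, y = j | y = b]) ->
    ~~ meets_bottom (cell_at T a b) ->
  se_corner T i a j b.
Proof.
move=> lt_ia lt_an lt_jb lt_bn H HU HD Tab.
apply: se_corner_cols => // x y le_x le_y.
  have [|_ ->//] := elbows_at_notin H (x := x) (y := y); first by rewrite /box; lia.
  by apply/negP => /HU[]; lia.
have [|->//] := elbows_at_notin H (x := x) (y := y); first by rewrite /box; lia.
by apply/negP => /HD[]; lia.
Qed.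

Lemma elbows_at_se_corner_rows (n i a j b : nat) (T : bpd n) (D U : seq (nat * nat)) :
    i < a -> a < n -> j < b -> b < n -> elbows_at T i a j b D U ->
    (forall x y, (x, y) \in U -> (x, y) = (a, b)) ->
    (forall x y, (x, y) \in D -> [\/ x = i, x = a | y = j]) ->
    ~~ meets_right (cell_at T a b) ->
  se_corner T i a j b.
Proof.
move=> lt_ia lt_an lt_jb lt_bn H HU HD Tab.
apply: se_corner_rows => // x y le_x le_y.
  have [|_ ->//] := elbows_at_notin H (x := x) (y := y); first by rewrite /box; lia.
  by apply/negP => /HU[]; lia.
have [|->//] := elbows_at_notin H (x := x) (y := y); first by rewrite /box; lia.
by apply/negP => /HD[]; lia.
Qed.

Lemma droop_demazure (n i a j b : nat) (P Q : bpd n) :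
  slide i a j b P Q -> cell_at P a b = Blank -> demazure P =1 demazure Q.
Proof.
move=> PQ Pab; have [eP eQ] := droop_elbows PQ Pab.
have [[lt_ia lt_an] [lt_jb lt_bn]] := ((slide_ia PQ, slide_an PQ), (slide_jb PQ, slide_bn PQ)).
have Qab : cell_at Q a b = UpElbow.
  by case: (slide_ab PQ) => -[]; rewrite Pab.
apply: (slide_demazure PQ (leqnn a) lt_an (leqnn b) lt_bn).
- apply: (elbows_at_se_corner_cols lt_ia lt_an lt_jb lt_bn eP); rewrite ?Pab // => x y; rewrite !inE.
  by move=> /eqP[-> ->]; constructor 1.
- apply: (elbows_at_se_corner_cols lt_ia lt_an lt_jb lt_bn eQ); rewrite ?Qab // => x y; rewrite !inE.
    by move/eqP.
  by case/orP=> /eqP[-> ->]; [constructor 2 | constructor 3].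
Qed.

(** In [P] the downward elbow [(a, j')] lies in a middle column, which excludes the criterion by
    columns; it lies in row [a], where the criterion by rows accepts it. *)
Lemma kdroop1_demazure (n i a j j' b : nat) (P Q : bpd n) :
    slide i a j j' P Q -> cell_at P a j' = DownElbow -> j' < b -> b < n ->
    elbows_at P i a j b [:: (i, j); (a, j')] [:: (a, b)] ->
  demazure P =1 demazure Q.
Proof.
move=> PQ Paj' lt_j'b lt_bn eP; have eQ := (kdroop1_elbows PQ Paj' lt_j'b).1 eP.
have [[lt_ia lt_an] lt_jj'] := (slide_ia PQ, slide_an PQ, slide_jb PQ).
have lt_jb := ltn_trans lt_jj' lt_j'b.
have inab : box i a j b a b by rewrite /box; lia.
have Pab : cell_at P a b = UpElbow.
  by have [_] := eP a b inab; rewrite mem_seq1 eqxx => /eqP.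
have Qab : cell_at Q a b = UpElbow.
  by have [_] := eQ a b inab; rewrite mem_seq1 eqxx => /eqP.
apply: (slide_demazure PQ (leqnn a) lt_an (ltnW lt_j'b) lt_bn).
- apply: (elbows_at_se_corner_rows lt_ia lt_an lt_jb lt_bn eP); rewrite ?Pab // => x y; rewrite !inE.
    by move/eqP.
  by case/orP=> /eqP[-> ->]; [constructor 1 | constructor 2].
- apply: (elbows_at_se_corner_rows lt_ia lt_an lt_jb lt_bn eQ); rewrite ?Qab // => x y; rewrite !inE.
    by move/eqP.
  by case/orP=> /eqP[-> ->]; [constructor 2 | constructor 1].
Qed.

(** Here the middle elbow lies in column [b], where the criterion by columns accepts it. *)
Lemma kdroop2_demazure (n i i' a j b : nat) (P Q : bpd n) :
    slide i i' j b P Q -> cell_at P i' b = DownElbow -> i' < a -> a < n ->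
    elbows_at P i a j b [:: (i, j); (i', b)] [:: (a, b)] ->
  demazure P =1 demazure Q.
Proof.
move=> PQ Pi'b lt_i'a lt_an eP; have eQ := kdroop2_elbows PQ Pi'b lt_i'a eP.
have [[lt_ii' lt_jb] lt_bn] := (slide_ia PQ, slide_jb PQ, slide_bn PQ).
have lt_ia := ltn_trans lt_ii' lt_i'a.
have inab : box i a j b a b by rewrite /box; lia.
have Pab : cell_at P a b = UpElbow.
  by have [_] := eP a b inab; rewrite mem_seq1 eqxx => /eqP.
have Qab : cell_at Q a b = UpElbow.
  by have [_] := eQ a b inab; rewrite mem_seq1 eqxx => /eqP.
apply: (slide_demazure PQ (ltnW lt_i'a) lt_an (leqnn b) lt_bn).
- apply: (elbows_at_se_corner_cols lt_ia lt_an lt_jb lt_bn eP); rewrite ?Pab // => x y; rewrite !inE.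
    by move/eqP.
  by case/orP=> /eqP[-> ->]; [constructor 1 | constructor 3].
- apply: (elbows_at_se_corner_cols lt_ia lt_an lt_jb lt_bn eQ); rewrite ?Qab // => x y; rewrite !inE.
    by move/eqP.
  by case/orP=> /eqP[-> ->]; [constructor 2 | constructor 3].
Qed.

Definition nat_cell (n : nat) (c : cell n) : nat * nat := (val c.1, val c.2).

(** The listed cells must lie in the box, since the intersections with [rect] discard all others. *)
Lemma elbows_inP (n : nat) (P : bpd n) (i a j b : 'I_n) (D U : {set cell n})
    (D' U' : seq (nat * nat)) :
    (forall c, (c \in D) = (nat_cell c \in D')) ->
    (forall c, (c \in U) = (nat_cell c \in U')) ->
    (forall x y, (x, y) \in D' ++ U' -> box i a j b x y) ->
  elbows_in P (rect i a j b) D U <-> elbows_at P i a j b D' U'.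
Proof.
move=> eqD eqU sub; split=> [/andP[/eqP eD /eqP eU] x y inb | H].
  have [ltxn ltyn] : x < n /\ y < n.
    by move: inb; rewrite /box; have := ltn_ord a; have := ltn_ord b; lia.
  pose c : cell n := (Ordinal ltxn, Ordinal ltyn).
  have := eqD c; have := eqU c; rewrite /nat_cell -eD -eU !inE /= -!cell_atE /=.
  by rewrite -/(box i a j b x y) inb !andbT => <- <-.
apply/andP; split; apply/eqP/setP => c; rewrite !inE -cell_atE -/(box i a j b c.1 c.2).
  rewrite eqD; have [/H[-> _]|nin] := boolP (box _ _ _ _ _ _); first by rewrite andbT.
  by rewrite andbF; apply/esym/negbTE; apply: contra nin => inD; apply: sub; rewrite mem_cat inD.
rewrite eqU; have [/H[_ ->]|nin] := boolP (box _ _ _ _ _ _); first by rewrite andbT.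
by rewrite andbF; apply/esym/negbTE; apply: contra nin => inU; apply: sub; rewrite mem_cat inU orbT.
Qed.

Lemma bpd_of_elbows_rect (n : nat) (P Q : bpd n) (i a j b : 'I_n) (D U : {set cell n})
    (D' U' : seq (nat * nat)) :
    (forall c, (c \in D) = (nat_cell c \in D')) ->
    (forall c, (c \in U) = (nat_cell c \in U')) ->
    (forall x y, (x, y) \in D' ++ U' -> box i a j b x y) ->
    elbows_at Q i a j b D' U' ->
    (forall x y, ~~ box i a j b x y -> cell_at Q x y = cell_at P x y) ->
  bpd_of_elbows ((downs P :\: rect i a j b) :|: D) ((ups P :\: rect i a j b) :|: U) = Some Q.
Proof.
move=> eqD eqU sub eQ out; apply/bpd_of_elbowsP.
have [/andP[/eqP eD /eqP eU]] := ((elbows_inP Q eqD eqU sub).2 eQ, tt).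
rewrite -eD -eU; split; apply/setP => c; rewrite !inE -!cell_atE -/(box i a j b c.1 c.2).
all: have [inb|/out->] := boolP (box _ _ _ _ _ _); by rewrite ?andbT ?andbF ?orbF ?orFb.
Qed.

(** * Moves *)

Lemma mem_cell1 (n : nat) (i j : 'I_n) (c : cell n) :
  (c \in [set (i, j)]) = (nat_cell c \in [:: (val i, val j)]).
Proof. by case: c => x y; rewrite !inE. Qed.

Lemma mem_cell2 (n : nat) (i j i' j' : 'I_n) (c : cell n) :
  (c \in [set (i, j); (i', j')])
  = (nat_cell c \in [:: (val i, val j); (val i', val j')]).
Proof. by case: c => x y; rewrite !inE. Qed.

Lemma mem_cell0 (n : nat) (c : cell n) : (c \in set0) = (nat_cell c \in [::]).
Proof. by rewrite inE. Qed.

Lemma allowed_apply (n : nat) (P : bpd n) (m : move n) : allowed P m ->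
  exists2 Q : bpd n, apply_move P m = Some Q & demazure P =1 demazure Q.
Proof.
case: m => [i a j b|i a j j' b|i i' a j b] /=.
- case/and4P=> lt_ia lt_jb /eqP Pab.
  move/(elbows_inP P (@mem_cell1 n i j) (@mem_cell0 n)) => eP.
  have {}eP : elbows_at P i a j b [:: (val i, val j)] [::].
    by apply: eP => x y; rewrite inE => /eqP[-> ->]; rewrite /box; lia.
  rewrite -cell_atE in Pab.
  have [||||||x y inb ne_ij ne_ab|Q PQ] := @slide_forward n i a j b P => //.
  + by have [] := eP i j (_ : box i a j b i j); [rewrite /box; lia | rewrite mem_seq1 eqxx => /eqP].
  + by left.
  + have [eD eU] := eP x y inb.
    by rewrite /elbow eD eU mem_seq1 (negbTE ne_ij).
  have [_ eQ] := droop_elbows PQ Pab.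
  exists Q; last exact: droop_demazure PQ Pab.
  apply: (bpd_of_elbows_rect (@mem_cell2 n a j i b) (@mem_cell1 n a b) _ eQ (slide_out PQ)).
  by move=> x y; rewrite !inE /box => /or3P[] /eqP[-> ->]; lia.
- case/and3P=> lt_ia /andP[lt_jj' lt_j'b].
  move/(elbows_inP P (@mem_cell2 n i j a j') (@mem_cell1 n a b)) => eP.
  have {}eP : elbows_at P i a j b [:: (val i, val j); (val a, val j')] [:: (val a, val b)].
    by apply: eP => x y; rewrite !inE /box => /or3P[] /eqP[-> ->]; lia.
  have Paj' : cell_at P a j' = DownElbow.
    have [] := eP a j' (_ : box i a j b a j'); first by rewrite /box; lia.
    by rewrite !inE eqxx orbT => /eqP.
  (* The slide stops at column [j'], with the middle elbow as its south-east corner; [(a, b)] stays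
     outside. *)
  have [||||||x y inb ne_ij ne_ab|Q PQ] := @slide_forward n i a j j' P => //.
  + have [] := eP i j (_ : box i a j b i j); first by rewrite /box; lia.
    by rewrite !inE eqxx => /eqP.
  + by right.
  + have inb' : box i a j b x y by move: inb; rewrite /box; lia.
    have [eD eU] := eP x y inb'; rewrite /elbow eD eU !inE (negbTE ne_ij) (negbTE ne_ab) /= xpair_eqE.
    by move: inb; rewrite /box; lia.
  have eQ := (kdroop1_elbows PQ Paj' lt_j'b).1 eP.
  exists Q; last exact: kdroop1_demazure PQ Paj' lt_j'b (ltn_ord b) eP.
  apply: (bpd_of_elbows_rect (@mem_cell2 n a j i j') (@mem_cell1 n a b) _ eQ).
    by move=> x y; rewrite !inE /box => /or3P[] /eqP[-> ->]; lia.
  by move=> x y out; apply: (slide_out PQ); apply: contra out; rewrite /box; lia.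
- case/and3P=> /andP[lt_ii' lt_i'a] lt_jb.
  move/(elbows_inP P (@mem_cell2 n i j i' b) (@mem_cell1 n a b)) => eP.
  have {}eP : elbows_at P i a j b [:: (val i, val j); (val i', val b)] [:: (val a, val b)].
    by apply: eP => x y; rewrite !inE /box => /or3P[] /eqP[-> ->]; lia.
  have Pi'b : cell_at P i' b = DownElbow.
    have [] := eP i' b (_ : box i a j b i' b); first by rewrite /box; lia.
    by rewrite !inE eqxx orbT => /eqP.
  (* Likewise the slide stops at row [i']. *)
  have [||||||x y inb ne_ij ne_ab|Q PQ] := @slide_forward n i i' j b P => //.
  + have [] := eP i j (_ : box i a j b i j); first by rewrite /box; lia.
    by rewrite !inE eqxx => /eqP.
  + by right.
  + have inb' : box i a j b x y by move: inb; rewrite /box; lia.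
    have [eD eU] := eP x y inb'; rewrite /elbow eD eU !inE (negbTE ne_ij) (negbTE ne_ab) /= xpair_eqE.
    by move: inb; rewrite /box; lia.
  have eQ := kdroop2_elbows PQ Pi'b lt_i'a eP.
  exists Q; last exact: kdroop2_demazure PQ Pi'b lt_i'a (ltn_ord a) eP.
  apply: (bpd_of_elbows_rect (@mem_cell2 n i' j i b) (@mem_cell1 n a b) _ eQ).
    by move=> x y; rewrite !inE /box => /or3P[] /eqP[-> ->]; lia.
  by move=> x y out; apply: (slide_out PQ); apply: contra out; rewrite /box; lia.
Qed.

(** * Inverse moves *)

Lemma nearest_left (n : nat) (T : bpd n) (x c : nat) : x < n -> c <= n -> hedge T x c ->
  exists y, [/\ y < c, cell_at T x y = DownElbow
    & forall t, y < t < c -> ~~ elbow (cell_at T x t)].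
Proof.
move=> ltxn; elim: c => [|c IHc] // ltcn hc.
have [hl hr _ _] := cell_edges T ltxn ltcn; rewrite -hr in hc.
have [eD|neD] := eqVneq (cell_at T x c) DownElbow.
  by exists c; split=> // t; lia.
have [|y [lt_yc Dy run]] := IHc (ltnW ltcn).
  by rewrite -hl; move: hc neD; case: cell_at.
exists y; split=> // [|t le_t]; first exact: ltnW.
have [->|ne_tc] := eqVneq t c; last by apply: run; lia.
by move: hc neD; case: cell_at.
Qed.

Lemma nearest_above (n : nat) (T : bpd n) (c y : nat) : y < n -> c <= n -> vedge T c y ->
  exists2 x, x < c & cell_at T x y = DownElbow.
Proof.
move=> ltyn; elim: c => [|c IHc] // ltcn vc.
have [_ _ vt vb] := cell_edges T ltcn ltyn; rewrite -vb in vc.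
have [eD|neD] := eqVneq (cell_at T c y) DownElbow; first by exists c.
have [|x lt_xc Dx] := IHc (ltnW ltcn); last by exists x => //; apply: ltnW.
by rewrite -vt; move: vc neD; case: cell_at.
Qed.

(** The pipe going east from [(x, y)] could only be turned by an upward elbow, yet the left edge of
    a downward elbow at [(x, y')] is empty. Two uses of the inequality give uniqueness. *)
Lemma row_down_uniq (n : nat) (T : bpd n) (x y y' : nat) :
    (forall t, y <= t <= y' -> cell_at T x t != UpElbow) ->
    cell_at T x y = DownElbow -> cell_at T x y' = DownElbow -> y' <= y.
Proof.
move=> noU Dy Dy'; rewrite leqNgt; apply/negP => lt_yy'.
have [ltxn lty'n] : x < n /\ y' < n.
  by apply/andP; apply: contraT => out; rewrite cell_at_out in Dy'.
have [_ hr _ _] := cell_edges T ltxn (ltn_trans lt_yy' lty'n).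
have [hl _ _ _] := cell_edges T ltxn lty'n.
have := @hedge_le n T x y.+1 y' ltxn lt_yy' (ltnW lty'n).
by rewrite -hl -hr Dy Dy' => /(_ _)/wrap[] // t le_t; apply: noU; lia.
Qed.

Lemma col_down_uniq (n : nat) (T : bpd n) (x x' y : nat) :
    (forall t, x <= t <= x' -> cell_at T t y != UpElbow) ->
    cell_at T x y = DownElbow -> cell_at T x' y = DownElbow -> x' <= x.
Proof.
move=> noU Dx Dx'; rewrite leqNgt; apply/negP => lt_xx'.
have [ltx'n ltyn] : x' < n /\ y < n.
  by apply/andP; apply: contraT => out; rewrite cell_at_out in Dx'.
have [_ _ _ vb] := cell_edges T (ltn_trans lt_xx' ltx'n) ltyn.
have [_ _ vt _] := cell_edges T ltx'n ltyn.
have := @vedge_le n T x.+1 x' y ltyn lt_xx' (ltnW ltx'n).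
by rewrite -vt -vb Dx Dx' => /(_ _)/wrap[] // t le_t; apply: noU; lia.
Qed.

Definition weight (n : nat) (T : bpd n) : nat :=
  \sum_(x < n) \sum_(y < n) vedge T x y * y.

(** Each line from [i.+1] to [a] gains [b - j], and line [a] is one of them. So the weight strictly
    drops along inverse moves, which makes them terminate. *)
Lemma slide_weight (n i a j b : nat) (P Q : bpd n) :
  slide i a j b P Q -> weight P < weight Q.
Proof.
move=> PQ; have [[lt_ia lt_an] [lt_jb lt_bn]] :=
  ((slide_ia PQ, slide_an PQ), (slide_jb PQ, slide_bn PQ)).
pose oj := Ordinal (ltn_trans lt_jb lt_bn); pose ob := Ordinal lt_bn.
pose oa := Ordinal lt_an.
have row (x : 'I_n) : \sum_(y < n) vedge P x y * y + (i < x <= a) * (b - j)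
    = \sum_(y < n) vedge Q x y * y.
  have [le_x|nle_x] := boolP (i < x <= a); last first.
    by rewrite addn0; apply: eq_bigr => y _; rewrite (slide_vedge_out PQ) ?nle_x.
  have ne_bj : ob != oj by rewrite -val_eqE /=; lia.
  have [Pj Qj Pb Qb] := slide_vedge_in PQ le_x.
  rewrite (bigD1 oj) //= [in RHS](bigD1 oj) //= (bigD1 ob) //= [in RHS](bigD1 ob) //=.
  rewrite Pj Qj Pb Qb; set sP := (X in _ + (_ + X) + _ = _).
  set sQ := (X in _ = _ + (_ + X)); have -> : sP = sQ; last by lia.
  apply: eq_bigr => y /andP[ne_yj ne_yb]; rewrite (slide_vedge_out PQ) //.
  by rewrite -!val_eqE /= in ne_yj ne_yb; rewrite ne_yj ne_yb orbT.
rewrite /weight (bigD1 oa) //= [X in _ < X](bigD1 oa) //=.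
rewrite -addSn; apply: leq_add; first by have := row oa; rewrite /= lt_ia leqnn; lia.
by apply: leq_sum => x _; rewrite -row leq_addr.
Qed.

Lemma topmost_up (n : nat) (Q : bpd n) : ups Q != set0 ->
  exists a b, cell_at Q a b = UpElbow /\
    forall x y, x < a -> cell_at Q x y != UpElbow.
Proof.
case/set0Pn=> c0 c0U; pose c := [arg min_(c < c0 in ups Q) (c.1 : nat)].
have [c1 c1U le_c1] : extremum_spec leq (mem (ups Q)) (fun c => c.1 : nat) c.
  by apply: arg_minnP.
exists c1.1, c1.2; split=> [|x y lt_x].
  by apply/eqP; have := c1U : c1 \in ups Q; rewrite inE -cell_atE.
apply/eqP => eU; have [ltxn ltyn] : x < n /\ y < n.
  by apply/andP; apply: contraT => out; rewrite cell_at_out in eU.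
have /le_c1 : (Ordinal ltxn, Ordinal ltyn) \in ups Q by rewrite inE -cell_atE /= eU.
by rewrite /= leqNgt lt_x.
Qed.

Lemma inverse_slide (n : nat) (Q : bpd n) : ups Q != set0 ->
  exists r a j t b P, [/\ slide r a j t P Q, t <= b, b < n, cell_at Q a b = UpElbow
    & elbows_at Q r a j b [:: (a, j); (r, t)] [:: (a, b)]].
Proof.
case/topmost_up=> a [b [Qab noU]].
have [lt_an lt_bn] : a < n /\ b < n.
  by apply/andP; apply: contraT => out; rewrite cell_at_out in Qab.
have [hab _ vab _] := cell_edges Q lt_an lt_bn; rewrite Qab /= in hab vab.
have [j [lt_jb Qaj run]] := nearest_left lt_an (ltnW lt_bn) (esym hab).
(* The pipe that goes up from [(a, b)] cannot reach the top boundary; the downward elbow where it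
   turns shows that some row satisfies [D]. *)
have [i lt_ia Qib] := nearest_above lt_bn (ltnW lt_an) (esym vab).
pose D x := [exists t : 'I_n, (j < t <= b) && (cell_at Q x t == DownElbow)].
have exD : exists x, (x < a) && D x.
  exists i; rewrite lt_ia; apply/existsP; exists (Ordinal lt_bn) => /=.
  by rewrite lt_jb leqnn Qib.
have ubD x : (x < a) && D x -> x <= a by case/andP => /ltnW.
(* The largest index is the lowest row: between rows [r] and [a] there is no downward elbow in the
   columns after [j] up to [b]. *)
case: (ex_maxnP exD ubD) => r /andP[lt_ra /existsP[t /andP[/andP[lt_jt le_tb] /eqP Qrt]]] maxr.
have lt_jn := ltn_trans lt_jb lt_bn; have lt_rn := ltn_trans lt_ra lt_an.
(* Below such an elbow the column would stay met down to row [a], as there is no upward elbow above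
   that row; but the top edge of [(a, j)] is empty. *)
have noDj x : x < a -> cell_at Q x j != DownElbow.
  move=> lt_xa; apply/eqP => Dxj; have lt_xn := ltn_trans lt_xa lt_an.
  have [_ _ _ vb] := cell_edges Q lt_xn lt_jn; have [_ _ vt _] := cell_edges Q lt_an lt_jn.
  have := @vedge_le n Q x.+1 a j lt_jn lt_xa (ltnW lt_an).
  rewrite -vb -vt Dxj Qaj => /(_ _)/wrap[] // z /andP[_ lt_za].
  exact: noU.
have eQ : elbows_at Q r a j b [:: (a, j); (r, val t)] [:: (a, b)].
  move=> x y /andP[/andP[le_rx le_xa] /andP[le_jy le_yb]]; rewrite !inE !xpair_eqE.
  have [Ex|ne_xa] := eqVneq x a.
    rewrite Ex (gtn_eqF lt_ra) /= orbF.
    have [->|ne_yj] := eqVneq y j; first by rewrite Qaj (ltn_eqF lt_jb).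
    have [->|ne_yb] := eqVneq y b; first by rewrite Qab.
    have /run : j < y < b by lia.
    by rewrite /elbow negb_or => /andP[/negbTE-> /negbTE->].
  have lt_xa : x < a by lia.
  rewrite (negbTE (noU x y lt_xa)) /=; split=> //.
  have [Ex|ne_xr] := eqVneq x r.
    rewrite Ex /=; apply/eqP/eqP => [Dry|->//].
    apply/eqP; rewrite eqn_leq; apply/andP; split.
      by apply: (row_down_uniq _ Qrt Dry) => z _; apply: noU.
    by apply: (row_down_uniq _ Dry Qrt) => z _; apply: noU.
  apply/eqP => Dxy; have [Ey|ne_yj] := eqVneq y j.
    by have := noDj x lt_xa; rewrite -Ey Dxy.
  have lt_yn := leq_ltn_trans le_yb lt_bn.
  have : (x < a) && D x.
    by rewrite lt_xa; apply/existsP; exists (Ordinal lt_yn); rewrite /= Dxy eqxx; lia.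
  by move/maxr; lia.
have Qat : cell_at Q a t != DownElbow.
  have [|-> _] := eQ a t; first by rewrite /box; lia.
  by rewrite !inE !xpair_eqE; lia.
have [x y inb ne_rt ne_aj ne_at|P PQ] :=
    @slide_backward n r a j t Q lt_ra lt_an lt_jt (ltn_ord t) Qrt Qaj Qat.
  have inb' : box r a j b x y by move: inb; rewrite /box; lia.
  have [eD eU] := eQ x y inb'; rewrite /elbow eD eU !inE (negbTE ne_rt) (negbTE ne_aj) /=.
  by apply: contra ne_at; move: inb; rewrite /box !xpair_eqE; lia.
by exists r, a, j, (val t), b, P.
Qed.

Lemma inverse_move (n : nat) (Q : bpd n) : ups Q != set0 ->
  exists P m, [/\ weight P < weight Q, allowed P m & apply_move P m = Some Q].
Proof.
case/inverse_slide=> r [a [j [t [b [P [PQ le_tb lt_bn Qab eQ]]]]]].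
have [[lt_ra lt_an] [lt_jt lt_tn]] :=
  ((slide_ia PQ, slide_an PQ), (slide_jb PQ, slide_bn PQ)).
pose r' := Ordinal (ltn_trans lt_ra lt_an); pose a' := Ordinal lt_an.
pose j' := Ordinal (ltn_trans lt_jt lt_tn); pose t' := Ordinal lt_tn.
pose b' := Ordinal lt_bn; have lt_PQ := slide_weight PQ.
(* If [t = b], the slide ends at the upward elbow, so [P] is blank there and the move is a droop.
   Otherwise [Q] has no elbow at [(a, t)], so [P] has a downward one there and the move is of the
   first K-theoretic type. *)
have [Etb|ne_tb] := eqVneq t b.
  have Pab : cell_at P a t = Blank by case: (slide_ab PQ) => -[]; rewrite Etb Qab.
  have [eP _] := droop_elbows PQ Pab.
  exists P, (Droop r' a' j' t'); split=> //.
    apply/and4P; split=> //; first by rewrite -cell_atE Pab.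
    apply/(elbows_inP P (@mem_cell1 n r' j') (@mem_cell0 n)) => // x y.
    by rewrite mem_seq1 => /eqP[-> ->]; rewrite /box /=; lia.
  apply: (@bpd_of_elbows_rect n P Q r' a' j' t' _ _ _ _ (@mem_cell2 n a' j' r' t')
    (@mem_cell1 n a' t') _ _ (slide_out PQ)).
    by move=> x y; rewrite !inE /box /= => /or3P[] /eqP[-> ->]; lia.
  by rewrite /= -Etb in eQ *.
have lt_tb : t < b by lia.
have Pat : cell_at P a t = DownElbow.
  case: (slide_ab PQ) => -[] // _ Qat.
  have [|_] := eQ a t; first by rewrite /box; lia.
  by rewrite Qat mem_seq1 xpair_eqE (ltn_eqF lt_tb) andbF.
have eP := (kdroop1_elbows PQ Pat lt_tb).2 eQ.
exists P, (KDroop1 r' a' j' t' b'); split=> //.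
  apply/and3P; split=> //=; first by rewrite lt_jt.
  apply/(elbows_inP P (@mem_cell2 n r' j' a' t') (@mem_cell1 n a' b')) => // x y.
  by rewrite !inE /box /= => /or3P[] /eqP[-> ->]; lia.
apply: (@bpd_of_elbows_rect n P Q r' a' j' b' _ _ _ _ (@mem_cell2 n a' j' r' t')
  (@mem_cell1 n a' b') _ eQ).
  by move=> x y; rewrite !inE /box /= => /or3P[] /eqP[-> ->]; lia.
by move=> x y out; apply: (slide_out PQ); apply: contra out; rewrite /box /=; lia.
Qed.

(** The pipe leaving a row on the right starts at a downward elbow of that row. Without upward
    elbows no row or column has two downward ones, so they form a permutation matrix. *)
Lemma no_up_rothe (n : nat) (P : bpd n) : ups P = set0 ->
  exists u : 'S_n, P = rothe u.
Proof.
move=> noU; have noU' x y : cell_at P x y != UpElbow.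
  have [/andP[ltxn ltyn]|out] := boolP ((x < n) && (y < n)); last by rewrite cell_at_out.
  by move/setP/(_ (Ordinal ltxn, Ordinal ltyn)): noU; rewrite !inE -cell_atE /= => ->.
(* The default [i] is never returned, by [fP]. *)
pose f (i : 'I_n) := odflt i [pick y | P i y == DownElbow].
have fP i : P i (f i) = DownElbow.
  rewrite /f; case: pickP => [y /eqP //|noD].
  have [y [ltyn Dy _]] := nearest_left (ltn_ord i) (leqnn n) (hedge_last P (ltn_ord i)).
  by have := noD (Ordinal ltyn); rewrite -cell_atE Dy.
have finj : injective f.
  move=> i i' eqf; have := fP i; have := fP i'; rewrite -eqf -!cell_atE => Di' Di.
  apply/val_inj/eqP; rewrite eqn_leq.
  by rewrite (col_down_uniq _ Di' Di) ?(col_down_uniq _ Di Di').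
exists (perm finj); have [rD rU] := rothe_elbows (perm finj).
apply: bpd_elbows_inj; last by rewrite rU.
rewrite rD; apply/setP => -[x y]; rewrite inE /=.
apply/eqP/imsetP => [Dxy|[i _ [-> ->]]]; last by rewrite permE.
exists x => //; rewrite permE; congr (_, _); apply/val_inj/eqP; rewrite eqn_leq.
rewrite -cell_atE in Dxy; have := fP x; rewrite -cell_atE => Dfx.
by rewrite (row_down_uniq _ Dfx Dxy) ?(row_down_uniq _ Dxy Dfx).
Qed.

Lemma Pipes_demazure (n : nat) (w : 'S_n) (P Q : bpd n) :
  demazure P =1 demazure Q -> (P \in Pipes w) = (Q \in Pipes w).
Proof. by move=> ePQ; rewrite !inE; apply: eq_forallb => i; rewrite ePQ. Qed.

Theorem proposition4p5 (n : nat) (w : 'S_n) :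
  (forall (P : bpd n) (m : move n), P \in Pipes w -> allowed P m ->
     exists2 Q : bpd n, apply_move P m = Some Q & Q \in Pipes w)
  /\
  (forall P : bpd n, P \in Pipes w ->
     clos_refl_trans (bpd n) (@move_step n) (rothe w) P).
Proof.
split=> [P m Pw /allowed_apply[Q PmQ ePQ]|P].
  by exists Q => //; rewrite -(Pipes_demazure w ePQ).
have [k] := ubnP (weight P); elim: k P => // k IHk P le_Pk Pw.
have [/no_up_rothe[u Pu]|/inverse_move[P' [m [lt_P'P P'm P'P]]]] := eqVneq (ups P) set0.
  (* The Demazure product of the Rothe BPD of [u] is [u], and that of [P] is [w]. *)
  suff <- : u = w by rewrite Pu; apply: rt_refl.
  apply/permP => i; move: Pw; rewrite Pu inE => /forallP/(_ i)/eqP.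
  by have := rothe_Pipes u; rewrite inE => /forallP/(_ i)/eqP -> [].
(* The move takes [P'] to [P], so invariance under moves also carries membership in [Pipes w] back
   to [P']. *)
have [Q] := allowed_apply P'm; rewrite P'P => -[<-] eP'P.
apply: (rt_trans _ _ _ P').
  apply: IHk; first by apply: leq_trans lt_P'P le_Pk.
  by rewrite (Pipes_demazure w eP'P).
by apply: rt_step; exists m.
Qed.
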